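(* Let $d>0$ and $k\ge3$ be fixed integers. As $b\to\infty$ through the integers $b>d$, the quantity $I(b,d,k)-b\log(b)$ has an asymptotic expansion to all orders in inverse powers of $b$. The start of this expansion is $$I(b,d,k)=b\log(b)+\frac{a_1(d)}{b^{2k-1}}+\frac{a_2(d)}{b^{2k}}+\frac{a_3(d)}{b^{2k+1}}+\frac{a_4(d)}{b^{2k+2}}+O(b^{-2k-3})$$ (implicit constant depending on $d$ and $k$) with, for $k\ge4$: \begin{align*} a_1(d)={}&(d+\tfrac12)d^{-2},\\ a_2(d)={}&\frac{(d+\frac12)\bigl((k-2)d+k-3\bigr)}{d^2(d+1)},\\ a_3(d)={}&(d+\tfrac12)\zeta(2)+(d+\tfrac12)\frac{(k^2-5k+4)d^3+(2k^2-12k+8)d^2+(k^2-7k+1)d-2}{2d^3(d+1)^2},\\ a_4(d)={}&(d+\tfrac12)\Bigl(-2d\,\zeta(3)+k\,\zeta(2)+\frac{P_k(d)}{6d^4(d+1)^3}\Bigr), \end{align*} where \begin{align*} P_k(d)={}&(k^3-9k^2+14k)d^5+(3k^3-30k^2+45k+42)d^4+(3k^3-33k^2+39k+114)d^3\\ &+(k^3-12k^2+2k+108)d^2+(-6k+43)d+6. \end{align*} For $k=3$, the formulas are valid except for $a_4(d)$, to which one must then add $(d^2-\frac13)/d^3$; that is, for $k=3$, $$a_4(d)=-(2d+1)d\,\zeta(3)+3(d+\tfrac12)\zeta(2)-\frac{12d^6-50d^4-81d^3-71d^2-33d-6}{12d^4(d+1)^3}.$$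
   Context: For integers $b\ge 2$, $0\le d<b$ and $k\ge 0$, $I(b,d,k)=\sum \frac1m$, where the sum runs over all integers $m>0$ whose base-$b$ representation (without leading zeros) contains exactly $k$ occurrences of the digit $d$ (this series converges). $\zeta$ is the Riemann zeta function. A function $f$ of the integer $b$ has an asymptotic expansion to all orders in inverse powers of $b$ if there are coefficients $a_n$ independent of $b$ (but depending on $d$ and $k$) such that for every $N$, $f(b)=\sum_{n\le N}a_nb^{-n}+O(b^{-N-1})$ as $b\to\infty$. *)

(* Defs.v *)
From Stdlib Require Import Reals Lra Lia Arith.
From Coquelicot Require Import Coquelicot.
From Stdlib Require Import List.
Import ListNotations.
Open Scope R_scope.

Fixpoint digits_fuel (fuel b m : nat) : list nat :=
  match fuel with
  | O => []
  | S fuel' =>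
      if Nat.eqb m 0 then []
      else Nat.modulo m b :: digits_fuel fuel' b (Nat.div m b)
  end.

(* Base-b digits, least significant first; since b >= 2, m is enough fuel.
   The lemma [digits_spec] characterizes the result, and [last _ 1 <> 0] there
   says that there is no leading zero ([digits b 0] is empty). *)
Definition digits (b m : nat) : list nat := digits_fuel m b m.

Lemma digits_spec (b m : nat) : (2 <= b)%nat ->
  fold_right (fun c v => (c + b * v)%nat) 0%nat (digits b m) = m /\
  Forall (fun c => (c < b)%nat) (digits b m) /\
  last (digits b m) 1%nat <> 0%nat.
Proof.
intros hb; unfold digits.
enough (H : forall fuel n, (n <= fuel)%nat ->
  fold_right (fun c v => (c + b * v)%nat) 0%nat (digits_fuel fuel b n) = n /\
  Forall (fun c => (c < b)%nat) (digits_fuel fuel b n) /\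
  last (digits_fuel fuel b n) 1%nat <> 0%nat) by (apply H; lia).
induction fuel as [|fuel IH]; intros n hn; cbn [digits_fuel].
- cbn; repeat split; [lia | constructor | lia].
- destruct (Nat.eqb_spec n 0) as [-> | hn0].
  + cbn; repeat split; [constructor | lia].
  + assert (hlt : (n / b < n)%nat) by (apply Nat.div_lt; lia).
    destruct (IH (n / b)%nat ltac:(lia)) as (h1 & h2 & h3).
    pose proof (Nat.div_mod_eq n b) as hdm.
    cbn [fold_right]; rewrite h1.
    repeat split; [lia | constructor; [apply Nat.mod_upper_bound; lia | exact h2] |].
    destruct (digits_fuel fuel b (n / b)) as [|c l] eqn:E; [|exact h3].
    cbn in h1 |- *; rewrite <- h1 in hdm; lia.
Qed.

Definition digit_count (b d m : nat) : nat :=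
  count_occ Nat.eq_dec (digits b m) d.

(* The term of index n is the contribution of the positive integer m = n + 1. *)
Definition irwin_sum (b d k : nat) : R :=
  Series (fun n => if Nat.eqb (digit_count b d (S n)) k then / INR (S n) else 0).

(* The Riemann zeta function on real arguments s > 1. *)
Definition zeta (s : R) : R := Series (fun n => / Rpower (INR (S n)) s).

Definition is_bigO (f g : nat -> R) : Prop :=
  exists C : R, eventually (fun b => Rabs (f b) <= C * Rabs (g b)).

Definition is_asymptotic_expansion (f a : nat -> R) : Prop :=
  forall N : nat,
    is_bigO (fun b => f b - sum_f_R0 (fun n => a n * / INR b ^ n) N)
            (fun b => / INR b ^ (N + 1)).

Definition coef1 (d : R) : R := (d + 1 / 2) * / d ^ 2.

Definition coef2 (d k : R) : R :=
  (d + 1 / 2) * ((k - 2) * d + k - 3) / (d ^ 2 * (d + 1)).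

Definition coef3 (d k : R) : R :=
  (d + 1 / 2) * zeta 2
  + (d + 1 / 2)
    * (((k ^ 2 - 5 * k + 4) * d ^ 3 + (2 * k ^ 2 - 12 * k + 8) * d ^ 2
        + (k ^ 2 - 7 * k + 1) * d - 2)
       / (2 * d ^ 3 * (d + 1) ^ 2)).

Definition coef4_poly (k d : R) : R :=
  (k ^ 3 - 9 * k ^ 2 + 14 * k) * d ^ 5
  + (3 * k ^ 3 - 30 * k ^ 2 + 45 * k + 42) * d ^ 4
  + (3 * k ^ 3 - 33 * k ^ 2 + 39 * k + 114) * d ^ 3
  + (k ^ 3 - 12 * k ^ 2 + 2 * k + 108) * d ^ 2
  + (- 6 * k + 43) * d + 6.

Definition coef4_generic (d k : R) : R :=
  (d + 1 / 2)
  * (- 2 * d * zeta 3 + k * zeta 2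
     + coef4_poly k d / (6 * d ^ 4 * (d + 1) ^ 3)).

Definition coef4 (d k : nat) : R :=
  coef4_generic (INR d) (INR k)
  + (if Nat.eqb k 3 then (INR d ^ 2 - 1 / 3) / INR d ^ 3 else 0).

(* Main.v *)
Require Import Defs.
From Stdlib Require Import Reals Lra Lia Arith.
From Coquelicot Require Import Coquelicot.
From Stdlib Require Import List.
Import ListNotations.
Open Scope R_scope.

(** Fix [b > d]. Giving each string [s] of [l] base-[b] digits with exactly [kappa - 1]
    occurrences of [d] the weight [b^-l] at the point [0.s] of the unit interval defines a
    discrete measure of total mass [b] when [kappa >= 1]; divided by [b] it is called [mean]
    below. An integer whose leading digit [c] is followed by the string [s] is
    [b^l (c + 0.s)], so the Irwin sum for [k] is [b] times the sum over [1 <= c < b] of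
    integrals of [1 / (c + x)] against these measures ([irwin_sum_mean]). Lebesgue measure
    in their place gives exactly [b ln b], hence only the deviation [dev] from Lebesgue
    measure matters.

    Both measures are self-similar: removing the first digit expresses [dev] on [f] through
    [dev] on the functions [f ((a + x) / b)], the index [kappa] dropping by one when [a = d]
    ([dev_digit]). Applied once to [1 / (c + x)] this gives functions [1 / (n + x)] with [n]
    an integer of two digits, so [n >= b] ([irwin_sum_dev2]). Since [dev] vanishes on
    constants when [kappa >= 1], Taylor's formula in [x] then reduces everything, up to an
    arbitrarily high power of [1 / b], to finitely many moments
    [v_m = dev (x^m)], [m >= 1], weighted by sums of [n^-(m+1)] over the two-digit integers
    with zero, one or two digits [d] ([irwin_sum_approx]).

    Applied to powers of [x], self-similarity yields a triangular recursion for the moments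
    ([moment_rec]). From it, [b^(2 kappa) v_m] has expansions of all orders in [1 / b], and is
    [O(1 / b)] when [m >= 2] and [kappa >= 1]; the first moment is exactly
    [- (d + 1/2) / (b^2 - b + 1)^kappa]. The weights have expansions because partial sums of
    [c^-s] do ([expands_zeta_sum], by discrete integration), whence the zeta values. This
    proves the existence of the expansion. Its first four coefficients only involve the
    moments of order at most three; their initial coefficients are computed explicitly. The
    recursion for the second moment starts at [kappa = 0] from minus the Lebesgue moments, and this
    irregular start is felt in the fourth coefficient exactly when [k = 3]. *)

(** * Finite sums *)

(** [rsum n f] is [f 0 + ... + f (n - 1)], with [n] terms. *)
Fixpoint rsum (n : nat) (f : nat -> R) : R :=
  match n with O => 0 | S n' => rsum n' f + f n' end.

Lemma rsum_ext n f g : (forall i, (i < n)%nat -> f i = g i) -> rsum n f = rsum n g.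
Proof.
intros H; induction n as [|n IH]; simpl; [reflexivity|].
rewrite IH; [rewrite (H n) by lia; reflexivity | intros i hi; apply H; lia].
Qed.

Lemma rsum_plus n f g : rsum n (fun i => f i + g i) = rsum n f + rsum n g.
Proof. induction n as [|n IH]; simpl; [ring | rewrite IH; ring]. Qed.

Lemma rsum_scal n c f : rsum n (fun i => c * f i) = c * rsum n f.
Proof. induction n as [|n IH]; simpl; [ring | rewrite IH; ring]. Qed.

Lemma rsum_const n c : rsum n (fun _ => c) = INR n * c.
Proof. induction n as [|n IH]; [simpl; ring | rewrite S_INR; simpl rsum; rewrite IH; ring]. Qed.

Lemma rsum_le n f g : (forall i, (i < n)%nat -> f i <= g i) -> rsum n f <= rsum n g.
Proof.
intros H; induction n as [|n IH]; simpl; [lra|].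
apply Rplus_le_compat; [apply IH; intros i hi; apply H; lia | apply H; lia].
Qed.

Lemma rsum_nonneg n f : (forall i, (i < n)%nat -> 0 <= f i) -> 0 <= rsum n f.
Proof.
intros H; replace 0 with (rsum n (fun _ => 0)) by (rewrite rsum_const; ring).
apply rsum_le; exact H.
Qed.

Lemma rsum_abs n f : Rabs (rsum n f) <= rsum n (fun i => Rabs (f i)).
Proof.
induction n as [|n IH]; simpl; [rewrite Rabs_R0; lra|].
eapply Rle_trans; [apply Rabs_triang | lra].
Qed.

Lemma rsum_first n f : rsum (S n) f = f 0%nat + rsum n (fun i => f (S i)).
Proof.
induction n as [|n IH]; [simpl; ring|].
change (rsum (S (S n)) f) with (rsum (S n) f + f (S n)); rewrite IH; simpl; ring.
Qed.

Lemma rsum_swap m n (f : nat -> nat -> R) :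
  rsum m (fun i => rsum n (fun j => f i j)) = rsum n (fun j => rsum m (fun i => f i j)).
Proof.
induction m as [|m IH]; simpl.
- rewrite rsum_const; ring.
- rewrite IH, <- rsum_plus; reflexivity.
Qed.

Lemma rsum_app m n f : rsum (m + n) f = rsum m f + rsum n (fun i => f (m + i)%nat).
Proof.
induction n as [|n IH]; [rewrite Nat.add_0_r; simpl; ring|].
rewrite Nat.add_succ_r; simpl; rewrite IH; ring.
Qed.

Lemma rsum_mul p q f :
  rsum (p * q) f = rsum p (fun c => rsum q (fun n => f (c * q + n)%nat)).
Proof.
induction p as [|p IH]; [reflexivity|].
replace (S p * q)%nat with (p * q + q)%nat by lia.
rewrite rsum_app, IH; reflexivity.
Qed.

Lemma rsum_pick n d f : (d < n)%nat ->
  rsum n (fun i => if Nat.eqb i d then f i else 0) = f d.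
Proof.
induction n as [|n IH]; [lia|]; intros h; simpl.
destruct (Nat.eqb_spec n d) as [-> | hne].
- rewrite (rsum_ext _ _ (fun _ => 0)).
  + rewrite rsum_const; ring.
  + intros i hi; destruct (Nat.eqb_spec i d); [lia | reflexivity].
- rewrite IH by lia; ring.
Qed.

Lemma sum_f_R0_rsum f n : sum_f_R0 f n = rsum (S n) f.
Proof. induction n as [|n IH]; simpl in *; [ring | rewrite IH; reflexivity]. Qed.

Lemma sum_n_rsum (f : nat -> R) n : sum_n f n = rsum (S n) f.
Proof.
induction n as [|n IH]; [rewrite sum_O; simpl; ring|].
rewrite sum_Sn, IH; reflexivity.
Qed.

(** * Asymptotic expansions in inverse powers of the index *)

Lemma INR_gt0 n : (1 <= n)%nat -> 0 < INR n.
Proof. intros h; apply lt_0_INR; lia. Qed.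

(** [f] is bounded for large arguments. *)
Definition bounded_ev (f : nat -> R) : Prop :=
  exists C, eventually (fun b => Rabs (f b) <= C).

Lemma bounded_ev_pos f : bounded_ev f ->
  exists C, 0 < C /\ eventually (fun b => Rabs (f b) <= C).
Proof.
intros [C [N H]]; exists (Rabs C + 1); split.
- pose proof (Rabs_pos C); lra.
- exists N; intros n hn; specialize (H n hn); pose proof (Rle_abs C); lra.
Qed.

Lemma bounded_ev_ext f g : eventually (fun b => f b = g b) -> bounded_ev f -> bounded_ev g.
Proof.
intros [N H] [C [N' H']]; exists C, (N + N')%nat; intros n hn.
rewrite <- H by lia; apply H'; lia.
Qed.

Lemma bounded_ev_le f g :
  eventually (fun b => Rabs (f b) <= Rabs (g b)) -> bounded_ev g -> bounded_ev f.
Proof.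
intros [N H] [C [N' H']]; exists C, (N + N')%nat; intros n hn.
eapply Rle_trans; [apply H; lia | apply H'; lia].
Qed.

Lemma bounded_ev_const c : bounded_ev (fun _ => c).
Proof. exists (Rabs c), 0%nat; intros; lra. Qed.

Lemma bounded_ev_plus f g : bounded_ev f -> bounded_ev g -> bounded_ev (fun b => f b + g b).
Proof.
intros [C [N H]] [C' [N' H']]; exists (C + C'), (N + N')%nat; intros n hn.
eapply Rle_trans; [apply Rabs_triang|].
specialize (H n ltac:(lia)); specialize (H' n ltac:(lia)); lra.
Qed.

Lemma bounded_ev_mul f g : bounded_ev f -> bounded_ev g -> bounded_ev (fun b => f b * g b).
Proof.
intros [C [N H]] [C' [N' H']]; exists (C * C'), (N + N')%nat; intros n hn.
rewrite Rabs_mult; apply Rmult_le_compat; try apply Rabs_pos; [apply H | apply H']; lia.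
Qed.

Lemma bounded_ev_inv : bounded_ev (fun b => / INR b).
Proof.
exists 1, 1%nat; intros n hn.
assert (1 <= INR n) by (apply (le_INR 1); lia).
rewrite Rabs_right by (apply Rle_ge, Rlt_le, Rinv_0_lt_compat; lra).
rewrite <- Rinv_1; apply Rinv_le_contravar; lra.
Qed.

(** [jet [c0; ...; cn] f] says that [f b = c0 + c1 / b + ... + cn / b^n + O(b^-(n+1))];
    the empty jet says that [f] is bounded for large [b]. *)
Fixpoint jet (l : list R) (f : nat -> R) : Prop :=
  match l with
  | [] => bounded_ev f
  | c :: l' => jet l' (fun b => INR b * (f b - c))
  end.

Lemma jet_ext l : forall f g, eventually (fun b => f b = g b) -> jet l f -> jet l g.
Proof.
induction l as [|c l IH]; intros f g H hf; simpl in *.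
- exact (bounded_ev_ext _ _ H hf).
- eapply IH; [|exact hf].
  destruct H as [N H]; exists N; intros n hn; rewrite H by lia; reflexivity.
Qed.

Lemma jet_bounded l : forall f, jet l f -> bounded_ev f.
Proof.
induction l as [|c l IH]; intros f hf; simpl in *; [exact hf|].
apply IH in hf.
apply (bounded_ev_ext (fun b => c + / INR b * (INR b * (f b - c)))).
- exists 1%nat; intros n hn; pose proof (INR_gt0 n hn); field; lra.
- apply bounded_ev_plus; [apply bounded_ev_const|].
  apply bounded_ev_mul; [apply bounded_ev_inv | exact hf].
Qed.

(** Sums, and products below, of coefficient lists are truncated to the shorter list. *)
Fixpoint addl (l l' : list R) : list R :=
  match l, l' with
  | c :: l1, c' :: l1' => (c + c') :: addl l1 l1'
  | _, _ => []
  end.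

Definition scall (a : R) (l : list R) : list R := map (Rmult a) l.

(** The coefficients of the product of two expansions. *)
Fixpoint mull (l l' : list R) : list R :=
  match l, l' with
  | c :: l1, c' :: l1' => (c * c') :: addl (scall c l1') (mull l1 l')
  | _, _ => []
  end.

Lemma addl_length l : forall l', length (addl l l') = Nat.min (length l) (length l').
Proof. induction l as [|c l IH]; intros [|c' l']; simpl; auto. Qed.

Lemma mull_length l : forall l', length (mull l l') = Nat.min (length l) (length l').
Proof.
induction l as [|c l IH]; intros [|c' l']; simpl; auto.
rewrite addl_length, IH; unfold scall; rewrite length_map; simpl; lia.
Qed.

Lemma jet_plus l : forall l' f g, jet l f -> jet l' g -> jet (addl l l') (fun b => f b + g b).
Proof.
induction l as [|c l IH]; intros [|c' l'] f g hf hg;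
  try (apply bounded_ev_plus; eapply jet_bounded; eassumption).
cbn [jet addl] in *.
eapply jet_ext; [|apply (IH l' _ _ hf hg)].
exists 0%nat; intros; ring.
Qed.

Lemma jet_scal a l : forall f, jet l f -> jet (scall a l) (fun b => a * f b).
Proof.
induction l as [|c l IH]; intros f hf; cbn [jet scall map] in *.
- apply bounded_ev_mul; [apply bounded_ev_const | exact hf].
- eapply jet_ext; [|apply (IH _ hf)]; exists 0%nat; intros; ring.
Qed.

Lemma jet_mul l : forall l' f g, jet l f -> jet l' g -> jet (mull l l') (fun b => f b * g b).
Proof.
induction l as [|c l IH]; intros [|c' l'] f g hf hg;
  try (apply bounded_ev_mul; eapply jet_bounded; eassumption).
pose proof (IH (c' :: l') _ _ hf hg) as h.
cbn [jet mull] in *.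
eapply jet_ext; [|apply (jet_plus _ _ _ _ (jet_scal c _ _ hg) h)].
exists 0%nat; intros; ring.
Qed.

Lemma jet_zero n : jet (repeat 0 n) (fun _ => 0).
Proof.
induction n as [|n IH]; simpl; [apply bounded_ev_const|].
eapply jet_ext; [|exact IH]; exists 0%nat; intros; ring.
Qed.

Lemma jet_const c n : jet (c :: repeat 0 n) (fun _ => c).
Proof. simpl; eapply jet_ext; [|apply (jet_zero n)]; exists 0%nat; intros; ring. Qed.

Lemma jet_shift l f : jet l f -> jet (0 :: l) (fun b => / INR b * f b).
Proof.
intros hf; simpl; eapply jet_ext; [|exact hf].
exists 1%nat; intros n hn; pose proof (INR_gt0 n hn); field; lra.
Qed.

Lemma jet_prefix l l' : forall f, jet (l ++ l') f -> jet l f.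
Proof.
induction l as [|c l IH]; intros f hf; simpl in *; [exact (jet_bounded _ _ hf) | auto].
Qed.

Lemma jet_lim c l f : jet (c :: l) f -> is_lim_seq f c.
Proof.
intros hf; simpl in hf; apply jet_bounded, bounded_ev_pos in hf.
destruct hf as [C [hC [N H]]].
apply is_lim_seq_le_le_loc with (u := fun n => c - C * / INR n) (w := fun n => c + C * / INR n).
- exists (N + 1)%nat; intros n hn; specialize (H n ltac:(lia)).
  pose proof (INR_gt0 n ltac:(lia)) as hp.
  rewrite Rabs_mult, (Rabs_right (INR n)) in H by lra.
  assert (h : Rabs (f n - c) <= C * / INR n).
  { apply Rmult_le_reg_l with (INR n); [exact hp|].
    replace (INR n * (C * / INR n)) with C by (field; lra); exact H. }
  apply Rabs_le_between in h; lra.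
- replace (Finite c) with (Rbar_minus c (C * 0)) by (simpl; f_equal; ring).
  apply is_lim_seq_minus'; [apply is_lim_seq_const|].
  apply (is_lim_seq_scal_l _ C 0).
  apply (is_lim_seq_inv _ p_infty); [apply is_lim_seq_INR | discriminate].
- replace (Finite c) with (Rbar_plus c (C * 0)) by (simpl; f_equal; ring).
  apply is_lim_seq_plus'; [apply is_lim_seq_const|].
  apply (is_lim_seq_scal_l _ C 0).
  apply (is_lim_seq_inv _ p_infty); [apply is_lim_seq_INR | discriminate].
Qed.

(** The value at [x] of the polynomial with coefficient list [l]. *)
Fixpoint horner (l : list R) (x : R) : R :=
  match l with [] => 0 | c :: l' => c + x * horner l' x end.

Lemma jet_horner l : forall f r, bounded_ev r ->
  eventually (fun b => f b = horner l (/ INR b) + r b * (/ INR b) ^ length l) -> jet l f.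
Proof.
induction l as [|c l IH]; intros f r hr H.
- simpl in *; apply (bounded_ev_ext r); [|exact hr].
  destruct H as [N H]; exists N; intros n hn; rewrite H by lia; ring.
- cbn [jet]; apply (IH _ r hr).
  destruct H as [N H]; exists (N + 1)%nat; intros n hn; rewrite H by lia.
  pose proof (INR_gt0 n ltac:(lia)).
  cbn [length horner pow]; set (x := (/ INR n) ^ length l); field; lra.
Qed.

Lemma jet_horner_remainder l : forall f, jet l f ->
  exists r, bounded_ev r /\
    eventually (fun b => f b = horner l (/ INR b) + r b * (/ INR b) ^ length l).
Proof.
induction l as [|c l IH]; intros f hf; simpl in hf.
- exists f; split; [exact hf | exists 0%nat; intros; simpl; ring].
- destruct (IH _ hf) as [r [hr [N H]]].
  exists r; split; [exact hr|].
  exists (N + 1)%nat; intros n hn; specialize (H n ltac:(lia)).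
  pose proof (INR_gt0 n ltac:(lia)).
  cbn [length horner pow].
  apply Rmult_eq_reg_l with (INR n); [|lra].
  replace (INR n * f n) with (INR n * (f n - c) + INR n * c) by ring.
  rewrite H; set (x := (/ INR n) ^ length l); field; lra.
Qed.

(** [f] has an expansion in inverse powers of its argument with [N] coefficients,
    respectively expansions of every order. *)
Definition expands_to (N : nat) (f : nat -> R) : Prop :=
  exists l, length l = N /\ jet l f.
Definition expands (f : nat -> R) : Prop := forall N, expands_to N f.

Lemma expands_ext f g : eventually (fun b => f b = g b) -> expands f -> expands g.
Proof.
intros H hf N; destruct (hf N) as [l [hl hj]]; exists l; split; [exact hl|].
exact (jet_ext _ _ _ H hj).
Qed.

Lemma expands_plus f g : expands f -> expands g -> expands (fun b => f b + g b).
Proof.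
intros hf hg N; destruct (hf N) as [l [hl hj]], (hg N) as [l' [hl' hj']].
exists (addl l l'); split; [rewrite addl_length; lia | apply jet_plus; assumption].
Qed.

Lemma expands_mul f g : expands f -> expands g -> expands (fun b => f b * g b).
Proof.
intros hf hg N; destruct (hf N) as [l [hl hj]], (hg N) as [l' [hl' hj']].
exists (mull l l'); split; [rewrite mull_length; lia | apply jet_mul; assumption].
Qed.

Lemma expands_const c : expands (fun _ => c).
Proof.
intros [|N]; [exists []; split; [reflexivity | apply bounded_ev_const]|].
exists (c :: repeat 0 N); split; [simpl; rewrite repeat_length; reflexivity | apply jet_const].
Qed.

Lemma expands_inv : expands (fun b => / INR b).
Proof.
intros N; destruct (expands_const 1 (Nat.pred N)) as [l [hl hj]].
destruct N as [|N]; [exists []; split; [reflexivity | apply bounded_ev_inv]|].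
exists (0 :: l); split; [simpl in *; lia|].
eapply jet_ext; [|apply (jet_shift _ _ hj)]; exists 0%nat; intros; ring.
Qed.

Lemma expands_opp f : expands f -> expands (fun b => - f b).
Proof.
intros hf; apply (expands_ext (fun b => (-1) * f b)); [exists 0%nat; intros; ring|].
apply expands_mul; [apply expands_const | exact hf].
Qed.

Lemma expands_minus f g : expands f -> expands g -> expands (fun b => f b - g b).
Proof. intros hf hg; apply (expands_plus f _ hf (expands_opp _ hg)). Qed.

Lemma expands_pow f n : expands f -> expands (fun b => f b ^ n).
Proof.
intros hf; induction n as [|n IH]; simpl; [apply expands_const | apply expands_mul; assumption].
Qed.

Lemma expands_rsum n (f : nat -> nat -> R) :
  (forall i, (i < n)%nat -> expands (f i)) -> expands (fun b => rsum n (fun i => f i b)).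
Proof.
intros H; induction n as [|n IH]; simpl; [apply expands_const|].
apply expands_plus; [apply IH; intros; apply H; lia | apply H; lia].
Qed.

Lemma expands_bounded f : expands f -> bounded_ev f.
Proof. intros hf; destruct (hf 0%nat) as [l [_ hj]]; exact (jet_bounded _ _ hj). Qed.

Lemma expands_to_le M N f : (N <= M)%nat -> expands_to M f -> expands_to N f.
Proof.
intros h [l [hl hj]]; exists (firstn N l); split.
- rewrite length_firstn; lia.
- apply (jet_prefix _ (skipn N l)); rewrite firstn_skipn; exact hj.
Qed.

(** The coefficient lists of various lengths have the same head, namely the limit. *)
Lemma expands_dec f : expands f -> exists c, expands (fun b => INR b * (f b - c)).
Proof.
intros hf.
destruct (hf 1%nat) as [[|c l] [hl hj]]; [discriminate|].
exists c; intros N; destruct (hf (S N)) as [[|c' l'] [hl' hj']]; [discriminate|].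
assert (c = c') as ->.
{ pose proof (is_lim_seq_unique _ _ (jet_lim _ _ _ hj)) as e.
  rewrite (is_lim_seq_unique _ _ (jet_lim _ _ _ hj')) in e; congruence. }
exists l'; split; [simpl in hl'; lia | exact hj'].
Qed.

Lemma bounded_ev_denominator g : bounded_ev g ->
  eventually (fun b => 1 / 2 <= 1 + g b / INR b).
Proof.
intros hg; destruct (bounded_ev_pos _ hg) as [C [hC [N H]]].
destruct (nfloor_ex (2 * C) ltac:(lra)) as [M [_ hM]].
exists (N + M + 1)%nat; intros n hn; specialize (H n ltac:(lia)).
assert (hn' : 2 * C <= INR n).
{ apply Rle_trans with (INR M + 1); [lra|].
  rewrite <- S_INR; apply le_INR; lia. }
assert (Rabs (g n / INR n) <= 1 / 2).
{ unfold Rdiv at 1; rewrite Rabs_mult, Rabs_inv, (Rabs_right (INR n)) by lra.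
  apply Rmult_le_reg_r with (INR n); [lra|].
  replace (Rabs (g n) * / INR n * INR n) with (Rabs (g n)) by (field; lra); lra. }
apply Rabs_le_between in H0; lra.
Qed.

Lemma bounded_ev_inv_denominator g : bounded_ev g ->
  bounded_ev (fun b => / (1 + g b / INR b)).
Proof.
intros hg; destruct (bounded_ev_denominator g hg) as [N H].
exists 2, N; intros n hn; specialize (H n hn).
rewrite Rabs_right by (apply Rle_ge, Rlt_le, Rinv_0_lt_compat; lra).
replace 2 with (/ (1 / 2)) by field; apply Rinv_le_contravar; lra.
Qed.

(** If [f = 1 / (1 + g / b)] then [b * (f - 1) = - g * f]. *)
Lemma jet_inv_denominator l l' g : jet l g -> jet l' (fun b => / (1 + g b / INR b)) ->
  jet (1 :: scall (-1) (mull l l')) (fun b => / (1 + g b / INR b)).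
Proof.
intros hg hf; cbn [jet].
eapply jet_ext; [|apply jet_scal, (jet_mul _ _ _ _ hg hf)].
destruct (bounded_ev_denominator g (jet_bounded _ _ hg)) as [N H].
exists (N + 1)%nat; intros n hn; specialize (H n ltac:(lia)).
pose proof (INR_gt0 n ltac:(lia)).
assert (1 + g n / INR n <> 0) by lra.
assert (INR n + g n <> 0).
{ intros e; apply H1; replace (g n) with (- INR n) by lra; field; lra. }
field; split; lra.
Qed.

Lemma expands_inv_denominator g : expands g -> expands (fun b => / (1 + g b / INR b)).
Proof.
intros hg N; induction N as [|N [l' [hl' hj']]].
- exists []; split; [reflexivity|].
  apply bounded_ev_inv_denominator, expands_bounded, hg.
- destruct (hg N) as [l [hl hj]].
  exists (1 :: scall (-1) (mull l l')); split.
  + simpl; unfold scall; rewrite length_map, mull_length; lia.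
  + apply jet_inv_denominator; assumption.
Qed.

Lemma expands_compose_scal m f : (1 <= m)%nat -> expands f -> expands (fun b => f (m * b)%nat).
Proof.
intros hm hf N; revert f hf; induction N as [|N IH]; intros f hf.
- exists []; split; [reflexivity|].
  destruct (expands_bounded f hf) as [C [M H]]; exists C, M; intros n hn; apply H; nia.
- destruct (expands_dec f hf) as [c hc].
  destruct (IH _ hc) as [l [hl hj]].
  exists (c :: scall (/ INR m) l); split; [simpl; unfold scall; rewrite length_map; lia|].
  cbn [jet]; eapply jet_ext; [|apply (jet_scal (/ INR m) _ _ hj)].
  exists 0%nat; intros n _; rewrite mult_INR; pose proof (INR_gt0 m hm); field; lra.
Qed.

Lemma expands_compose_square f : expands f -> expands (fun b => f (b * b)%nat).
Proof.
intros hf N; revert f hf; induction N as [|N IH]; intros f hf.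
- exists []; split; [reflexivity|].
  destruct (expands_bounded f hf) as [C [M H]]; exists C, M; intros n hn; apply H; nia.
- destruct (expands_dec f hf) as [c hc].
  destruct (IH _ hc) as [l [hl hj]].
  apply (expands_to_le (S (S N))); [lia|].
  exists (c :: 0 :: l); split; [simpl; lia|].
  change (jet (0 :: l) (fun b => INR b * (f (b * b)%nat - c))).
  eapply jet_ext; [|apply (jet_shift _ _ hj)].
  exists 1%nat; intros n hn; rewrite mult_INR; pose proof (INR_gt0 n hn); field; lra.
Qed.

(** Effect on coefficients of replacing the index [b] by [m * b]. *)
Fixpoint dilate (m : nat) (l : list R) : list R :=
  match l with [] => [] | c :: l' => c :: scall (/ INR m) (dilate m l') end.

Lemma jet_compose_scal m l : (1 <= m)%nat -> forall f,
  jet l f -> jet (dilate m l) (fun b => f (m * b)%nat).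
Proof.
intros hm; induction l as [|c l IH]; intros f hf; cbn [jet dilate] in *.
- destruct hf as [C [M H]]; exists C, M; intros n hn; apply H; nia.
- eapply jet_ext; [|apply (jet_scal (/ INR m) _ _ (IH _ hf))].
  exists 0%nat; intros n _; rewrite mult_INR; pose proof (INR_gt0 m hm); field; lra.
Qed.

(** If [f] is, up to [O(b^-N)] for every [N], a function with expansions, then it has them. *)
Lemma expands_approx f :
  (forall N, exists g r, expands g /\ bounded_ev r /\
     eventually (fun b => f b = g b + r b * (/ INR b) ^ N)) -> expands f.
Proof.
intros H N; destruct (H N) as [g [r [hg [hr he]]]].
destruct (hg N) as [l [hl hj]]; exists l; split; [exact hl|].
destruct (jet_horner_remainder _ _ hj) as [r' [hr' he']].
apply (jet_horner _ _ (fun b => r' b + r b)); [apply bounded_ev_plus; assumption|].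
destruct he as [M he], he' as [M' he']; exists (M + M')%nat; intros n hn.
rewrite he, he', hl by lia; ring.
Qed.

(** The coefficients are obtained by repeatedly subtracting the limit and multiplying by the
    argument; no choice among the expansions of different lengths is needed. *)
Lemma expands_is_asymptotic_expansion f :
  expands f -> exists a, is_asymptotic_expansion f a.
Proof.
intros hf.
set (c := fun g : nat -> R => real (Lim_seq g)).
set (r := fix r n : nat -> R :=
  match n with O => f | S n' => fun b => INR b * (r n' b - c (r n')) end).
assert (hr : forall n, expands (r n)).
{ induction n as [|n IH]; [exact hf|].
  intros N; destruct (IH (S N)) as [[|e l] [hl hj]]; [discriminate|].
  exists l; split; [simpl in hl; lia|].
  assert (ec : c (r n) = e) by (unfold c; rewrite (is_lim_seq_unique _ _ (jet_lim _ _ _ hj)); reflexivity).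
  cbn [r]; rewrite ec; exact hj. }
exists (fun n => c (r n)); intros N.
destruct (expands_bounded _ (hr (S N))) as [C [M H]].
exists C, (M + 1)%nat; intros b hb.
pose proof (INR_gt0 b ltac:(lia)) as hp.
assert (e : forall n, f b - rsum n (fun n => c (r n) * / INR b ^ n) = r n b * / INR b ^ n).
{ induction n as [|n IH]; [simpl; field|].
  cbn [rsum]; replace (f b - (rsum n (fun n => c (r n) * / INR b ^ n) + c (r n) * / INR b ^ n))
    with (f b - rsum n (fun n => c (r n) * / INR b ^ n) - c (r n) * / INR b ^ n) by ring.
  rewrite IH; cbn [r pow]; field; split; [apply pow_nonzero|]; lra. }
rewrite sum_f_R0_rsum, e, Rabs_mult.
replace (N + 1)%nat with (S N) by lia.
apply Rmult_le_compat_r; [apply Rabs_pos | apply H; lia].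
Qed.

(** * Discrete integration of expansions; partial zeta sums and power sums *)

Lemma pow_inv_drop_lower (n M : nat) : (1 <= n)%nat ->
  (/ INR n) ^ S (S M) <= 2 ^ S M * ((/ INR n) ^ S M - (/ INR (S n)) ^ S M).
Proof.
intros hn; pose proof (INR_gt0 n hn) as hp.
assert (h1 : 1 <= INR n) by (apply (le_INR 1); lia).
rewrite S_INR.
set (x := / INR n); set (y := / (INR n + 1)).
assert (hx : 0 < x) by (apply Rinv_0_lt_compat; lra).
assert (hy : 0 < y) by (apply Rinv_0_lt_compat; lra).
assert (e : x - y = x * y) by (unfold x, y; field; lra).
assert (h2 : x <= 2 * y).
{ unfold x, y; apply Rmult_le_reg_l with (INR n * (INR n + 1)); [nra|].
  field_simplify; lra. }
assert (hxy : y <= x) by nra.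
assert (h3 : y ^ M <= x ^ M) by (apply pow_incr; lra).
assert (h4 : x ^ S M <= (2 * y) ^ S M) by (apply pow_incr; lra).
rewrite Rpow_mult_distr in h4.
assert (h5 : x * y ^ S M <= x ^ S M - y ^ S M).
{ simpl; replace (x * (y * y ^ M)) with ((x - y) * y ^ M) by (rewrite e; ring).
  pose proof (Rmult_le_compat_l x _ _ (Rlt_le _ _ hx) h3); lra. }
apply Rle_trans with (2 ^ S M * (x * y ^ S M)).
- change (x ^ S (S M)) with (x * x ^ S M).
  pose proof (Rmult_le_compat_l x _ _ (Rlt_le _ _ hx) h4); lra.
- apply Rmult_le_compat_l; [apply pow_le; lra | exact h5].
Qed.

(** A sequence whose increments are [O(n^-(M+2))] converges at the rate [O(n^-(M+1))]:
    adding or subtracting a multiple of [n^-(M+1)] makes it monotone. *)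
Lemma limit_rate a M :
  bounded_ev (fun n => INR n ^ S (S M) * (a (S n) - a n)) ->
  exists L, bounded_ev (fun n => INR n ^ S M * (a n - L)).
Proof.
intros hb; destruct (bounded_ev_pos _ hb) as [C [hC [N0 H0]]].
set (N := (N0 + 1)%nat).
set (K := C * 2 ^ S M).
assert (hK : 0 < K) by (apply Rmult_lt_0_compat; [lra | apply pow_lt; lra]).
set (t := fun m => (/ INR (N + m)) ^ S M).
set (u := fun m => a (N + m)%nat - K * t m).
set (w := fun m => a (N + m)%nat + K * t m).
assert (ht : forall m, 0 <= t m).
{ intros m; apply pow_le, Rlt_le, Rinv_0_lt_compat, INR_gt0; unfold N; lia. }
assert (hstep : forall m, Rabs (a (N + S m)%nat - a (N + m)%nat) <= K * (t m - t (S m))).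
{ intros m; specialize (H0 (N + m)%nat ltac:(unfold N; lia)).
  pose proof (pow_inv_drop_lower (N + m) M ltac:(unfold N; lia)) as h.
  pose proof (INR_gt0 (N + m) ltac:(unfold N; lia)) as hp.
  assert (hq : 0 < INR (N + m) ^ S (S M)) by (apply pow_lt; lra).
  rewrite Rabs_mult, (Rabs_right (INR (N + m) ^ S (S M))) in H0 by lra.
  unfold t; replace (N + S m)%nat with (S (N + m)) by lia.
  apply Rle_trans with (C * (/ INR (N + m)) ^ S (S M)).
  - rewrite pow_inv; apply Rmult_le_reg_l with (INR (N + m) ^ S (S M)); [exact hq|].
    eapply Rle_trans; [exact H0|]; right; field; lra.
  - unfold K; rewrite Rmult_assoc; apply Rmult_le_compat_l; lra. }
assert (hu : forall m, u m <= u (S m)).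
{ intros m; specialize (hstep m); apply Rabs_le_between in hstep; unfold u; lra. }
assert (hw : forall m, w (S m) <= w m).
{ intros m; specialize (hstep m); apply Rabs_le_between in hstep; unfold w; lra. }
assert (hu' : forall m j, u m <= u (m + j)%nat).
{ intros m j; induction j as [|j IH]; [rewrite Nat.add_0_r; lra|].
  rewrite Nat.add_succ_r; eapply Rle_trans; [exact IH | apply hu]. }
assert (hw' : forall m j, w (m + j)%nat <= w m).
{ intros m j; induction j as [|j IH]; [rewrite Nat.add_0_r; lra|].
  rewrite Nat.add_succ_r; eapply Rle_trans; [apply hw | exact IH]. }
assert (huw : forall m n, u m <= w n).
{ intros m n.
  assert (u (m + n)%nat <= w (n + m)%nat).
  { rewrite (Nat.add_comm n m).
    unfold u, w; pose proof (Rmult_le_pos K (t (m + n)%nat) ltac:(lra) (ht _)); lra. }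
  pose proof (hu' m n); pose proof (hw' n m); lra. }
destruct (ex_finite_lim_seq_incr u (w 0%nat) hu (fun m => huw m 0%nat)) as [L hL].
exists L, K, N; intros n hn.
replace n with (N + (n - N))%nat by lia; set (m := (n - N)%nat).
pose proof (is_lim_seq_incr_compare u L hL hu m) as h1.
assert (h2 : L <= w m).
{ apply (is_lim_seq_le u (fun _ => w m) L (w m)); [intros; apply huw | exact hL | apply is_lim_seq_const]. }
assert (hp : 0 < INR (N + m) ^ S M) by (apply pow_lt, INR_gt0; unfold N; lia).
rewrite Rabs_mult, (Rabs_right (INR (N + m) ^ S M)) by lra.
apply Rle_trans with (INR (N + m) ^ S M * (K * t m)).
- apply Rmult_le_compat_l; [lra|]; apply Rabs_le_between; unfold u, w in *; lra.
- unfold t; rewrite pow_inv; right; field; lra.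
Qed.

Lemma expands_succ_ratio : expands (fun n => INR n / INR (S n)).
Proof.
apply (expands_ext (fun n => / (1 + 1 / INR n))).
- exists 1%nat; intros n hn; rewrite S_INR; pose proof (INR_gt0 n hn); field; lra.
- apply expands_inv_denominator, expands_const.
Qed.

(** The expansion [n (1 - (n / (n + 1))^p) = p + O(1 / n)]. *)
Lemma expands_pow_drop p :
  expands (fun n => INR n * (INR n * (1 - (INR n / INR (S n)) ^ p) - INR p)).
Proof.
induction p as [|p IH].
- apply (expands_ext (fun _ => 0)); [exists 0%nat; intros; simpl; ring | apply expands_const].
- set (q := fun n => INR n * (1 - (INR n / INR (S n)) ^ p)) in *.
  assert (hq : expands q).
  { apply (expands_ext (fun n => INR p + / INR n * (INR n * (q n - INR p)))).
    - exists 1%nat; intros n hn; pose proof (INR_gt0 n hn); field; lra.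
    - apply expands_plus; [apply expands_const | apply expands_mul; [apply expands_inv | exact IH]]. }
  apply (expands_ext (fun n => INR n * (q n - INR p) - INR n / INR (S n) * (1 + q n))).
  + exists 1%nat; intros n hn; pose proof (INR_gt0 n hn); rewrite (S_INR p); unfold q.
    cbn [pow]; set (z := (INR n / INR (S n)) ^ p); rewrite S_INR; field; lra.
  + apply expands_minus; [exact IH|].
    apply expands_mul; [apply expands_succ_ratio|].
    apply expands_plus; [apply expands_const | exact hq].
Qed.

(** The leading term [c / n^(M+2)] of the increments of [g] is that of the increments of
    [- c / ((M + 1) n^(M+1))]; subtracting this function improves the order of the
    increments by one. The number [t] bounds how often this has to be done. *)
Lemma expands_integrate_aux N t : forall M g, (N <= S M + t)%nat ->
  expands (fun n => INR n ^ S (S M) * (g (S n) - g n)) -> expands_to N g.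
Proof.
induction t as [|t IH]; intros M g hN hg.
- destruct (limit_rate g M (expands_bounded _ hg)) as [L hL].
  apply (expands_to_le (S M)); [lia|].
  exists (L :: repeat 0 M); split; [simpl; rewrite repeat_length; reflexivity|].
  apply (jet_horner _ _ _ hL).
  exists 1%nat; intros n hn; pose proof (INR_gt0 n hn).
  cbn [length horner]; rewrite repeat_length.
  replace (horner (repeat 0 M) (/ INR n)) with 0
    by (clear; induction M as [|M IH]; simpl; [|rewrite <- IH]; ring).
  rewrite pow_inv; field; split; [apply pow_nonzero|]; lra.
- destruct (expands_dec _ hg) as [c hc].
  set (e := fun n => c / INR (S M) * (/ INR n) ^ S M).
  assert (he : expands e)
    by (apply expands_mul; [apply expands_const | apply expands_pow, expands_inv]).
  assert (h : expands_to N (fun n => g n + e n)).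
  { apply (IH (S M)); [lia|].
    apply (expands_ext (fun n => INR n * (INR n ^ S (S M) * (g (S n) - g n) - c)
       - c / INR (S M) *
           (INR n * (INR n * (1 - (INR n / INR (S n)) ^ S M) - INR (S M))))).
    - exists 1%nat; intros n hn; unfold e; pose proof (INR_gt0 n hn).
      pose proof (INR_gt0 (S n) ltac:(lia)).
      pose proof (INR_gt0 (S M) ltac:(lia)).
      unfold Rdiv at 2; rewrite Rpow_mult_distr, !pow_inv.
      change (INR n ^ S (S (S M))) with (INR n * (INR n * INR n ^ S M)).
      change (INR n ^ S (S M)) with (INR n * INR n ^ S M).
      assert (INR n ^ S M <> 0) by (apply pow_nonzero; lra).
      assert (INR (S n) ^ S M <> 0) by (apply pow_nonzero; lra).
      set (x := INR n ^ S M) in *; set (y := INR (S n) ^ S M) in *.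
      field; repeat split; lra.
    - apply expands_minus; [exact hc | apply expands_mul; [apply expands_const | apply expands_pow_drop]]. }
  destruct h as [l [hl hj]], (expands_opp _ he N) as [l' [hl' hj']].
  exists (addl l l'); split; [rewrite addl_length; lia|].
  eapply jet_ext; [|apply (jet_plus _ _ _ _ hj hj')]; exists 0%nat; intros; ring.
Qed.

Lemma expands_integrate M g :
  expands (fun n => INR n ^ S (S M) * (g (S n) - g n)) -> expands g.
Proof. intros hg N; apply (expands_integrate_aux N N M); [lia | exact hg]. Qed.

(** [zeta_sum s n] is the sum of [1 / c^s] over [1 <= c < n]. *)
Definition zeta_sum (s n : nat) : R := rsum (Nat.pred n) (fun i => (/ INR (S i)) ^ s).

Lemma zeta_sum_succ s n : (1 <= n)%nat -> zeta_sum s (S n) = zeta_sum s n + (/ INR n) ^ s.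
Proof. intros hn; destruct n as [|n]; [lia | reflexivity]. Qed.

Lemma zeta_sum_range s m n : (1 <= m)%nat ->
  zeta_sum s (m + n) - zeta_sum s m = rsum n (fun i => (/ INR (m + i)) ^ s).
Proof.
intros hm; induction n as [|n IH]; [rewrite Nat.add_0_r; simpl; ring|].
rewrite Nat.add_succ_r, zeta_sum_succ by lia; cbn [rsum]; rewrite <- IH; ring.
Qed.

Lemma expands_zeta_sum s : (2 <= s)%nat -> expands (zeta_sum s).
Proof.
intros hs; apply (expands_integrate 0).
apply (expands_ext (fun n => (/ INR n) ^ (s - 2))).
- exists 1%nat; intros n hn; rewrite zeta_sum_succ by exact hn.
  pose proof (INR_gt0 n hn).
  replace ((/ INR n) ^ s) with (/ INR n * (/ INR n * (/ INR n) ^ (s - 2)))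
    by (replace s with (S (S (s - 2))) at 2 by lia; reflexivity).
  set (z := (/ INR n) ^ (s - 2)); field; lra.
- apply expands_pow, expands_inv.
Qed.

Lemma zeta_sum_lim s : (2 <= s)%nat -> is_lim_seq (zeta_sum s) (zeta (INR s)).
Proof.
intros hs; destruct (expands_zeta_sum s hs 1%nat) as [[|c l] [hl hj]]; [discriminate|].
apply jet_lim in hj.
replace (zeta (INR s)) with c; [exact hj|].
unfold zeta, Series.
apply (is_lim_seq_incr_n _ 2) in hj; apply is_lim_seq_unique in hj.
rewrite <- (Lim_seq_ext (fun n => zeta_sum s (n + 2))), hj; [reflexivity|].
intros n; rewrite sum_n_rsum; unfold zeta_sum.
replace (Nat.pred (n + 2)) with (S n) by lia.
apply rsum_ext; intros i _; rewrite Rpower_pow, pow_inv; [reflexivity | apply INR_gt0; lia].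
Qed.

Lemma zeta_sum_jet1 s : (2 <= s)%nat -> jet [zeta (INR s)] (zeta_sum s).
Proof.
intros hs; destruct (expands_zeta_sum s hs 1%nat) as [[|c [|c' l]] [hl hj]]; try discriminate.
pose proof (is_lim_seq_unique _ _ (jet_lim _ _ _ hj)) as e.
rewrite (is_lim_seq_unique _ _ (zeta_sum_lim s hs)) in e.
injection e as ->; exact hj.
Qed.

Lemma zeta_sum_2_jet : jet [zeta 2; -1; -1/2; -1/6] (zeta_sum 2).
Proof.
set (h := fun n => 1 * / INR n + 1 / 2 * (/ INR n) ^ 2 + 1 / 6 * (/ INR n) ^ 3).
destruct (limit_rate (fun n => zeta_sum 2 n + h n) 3) as [L hL].
- (* The increment is exactly [- 1 / (6 n^3 (n + 1)^3)]. *)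
  apply (bounded_ev_ext (fun n => / INR n * (INR n / INR (S n)) ^ 3 * (- 1 / 6))).
  + exists 1%nat; intros n hn; unfold h; rewrite zeta_sum_succ by exact hn.
    rewrite S_INR; pose proof (INR_gt0 n hn); field; lra.
  + apply bounded_ev_mul; [|apply bounded_ev_const].
    apply bounded_ev_mul; [apply bounded_ev_inv | apply expands_bounded, expands_pow, expands_succ_ratio].
- assert (hj : jet [L; -1; -1/2; -1/6] (zeta_sum 2)).
  { apply (jet_horner _ _ _ hL).
    exists 1%nat; intros n hn; pose proof (INR_gt0 n hn); unfold h; cbn [horner length].
    field; lra. }
  replace (zeta 2) with L; [exact hj|].
  pose proof (is_lim_seq_unique _ _ (jet_lim _ _ _ hj)) as e.
  rewrite (is_lim_seq_unique _ _ (zeta_sum_lim 2 (le_n 2))) in e.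
  injection e as e; rewrite <- e; f_equal; simpl; ring.
Qed.

(** [shifted_sum d r t b] is the sum of [(c b + d)^-r (c b)^-t] over [1 <= c < b]. *)
Definition shifted_sum (d r t b : nat) : R :=
  rsum (Nat.pred b) (fun i =>
    (/ (INR (S i) * INR b + INR d)) ^ r * (/ (INR (S i) * INR b)) ^ t).

(** From [1 / (c b + d) = 1 / (c b) - d / ((c b) (c b + d))]. *)
Lemma shifted_sum_rec d r t b : (1 <= b)%nat ->
  shifted_sum d (S r) t b = shifted_sum d r (S t) b - INR d * shifted_sum d (S r) (S t) b.
Proof.
intros hb; unfold shifted_sum.
rewrite <- rsum_scal; unfold Rminus.
replace (- rsum (Nat.pred b) (fun i => INR d *
   ((/ (INR (S i) * INR b + INR d)) ^ S r * (/ (INR (S i) * INR b)) ^ S t)))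
 with ((-1) * rsum (Nat.pred b) (fun i => INR d *
   ((/ (INR (S i) * INR b + INR d)) ^ S r * (/ (INR (S i) * INR b)) ^ S t))) by ring.
rewrite <- rsum_scal, <- rsum_plus.
apply rsum_ext; intros i _.
pose proof (INR_gt0 b hb); pose proof (INR_gt0 (S i) ltac:(lia)); pose proof (pos_INR d).
assert (0 < INR (S i) * INR b) by nra.
cbn [pow]; set (x := (/ _) ^ r); set (y := (/ _) ^ t); field; lra.
Qed.

Lemma shifted_sum_0 d t b : (1 <= b)%nat -> INR b ^ t * shifted_sum d 0 t b = zeta_sum t b.
Proof.
intros hb; unfold shifted_sum, zeta_sum; rewrite <- rsum_scal.
apply rsum_ext; intros i _.
pose proof (INR_gt0 b hb); pose proof (INR_gt0 (S i) ltac:(lia)).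
rewrite Rinv_mult, Rpow_mult_distr, (pow_inv (INR b)), pow_O; field.
apply pow_nonzero; lra.
Qed.

Lemma shifted_sum_bounded d r t : (2 <= r + t)%nat ->
  bounded_ev (fun b => INR b ^ (r + t) * shifted_sum d r t b).
Proof.
intros h; apply (bounded_ev_le _ (zeta_sum (r + t))); [|apply expands_bounded, expands_zeta_sum, h].
exists 1%nat; intros b hb; rewrite <- (shifted_sum_0 d) by exact hb.
pose proof (INR_gt0 b hb).
rewrite !Rabs_mult; apply Rmult_le_compat_l; [apply Rabs_pos|].
unfold shifted_sum.
assert (hpos : forall i n, 0 < (/ (INR (S i) * INR b)) ^ n).
{ intros i n; apply pow_lt, Rinv_0_lt_compat; pose proof (INR_gt0 (S i) ltac:(lia)); nra. }
assert (hpos' : forall i n, 0 < (/ (INR (S i) * INR b + INR d)) ^ n).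
{ intros i n; apply pow_lt, Rinv_0_lt_compat; pose proof (INR_gt0 (S i) ltac:(lia));
  pose proof (pos_INR d); nra. }
rewrite !Rabs_right; try (apply Rle_ge, rsum_nonneg; intros i _;
  apply Rmult_le_pos; try (simpl; lra); apply Rlt_le; auto).
apply rsum_le; intros i _; rewrite pow_add; simpl (_ ^ 0); rewrite Rmult_1_l.
apply Rmult_le_compat_r; [apply Rlt_le; auto|].
apply pow_incr; pose proof (INR_gt0 (S i) ltac:(lia)); pose proof (pos_INR d).
split; [apply Rlt_le, Rinv_0_lt_compat; nra | apply Rinv_le_contravar; nra].
Qed.

Lemma expands_shifted_sum d r t : (2 <= r + t)%nat ->
  expands (fun b => INR b ^ (r + t) * shifted_sum d r t b).
Proof.
intros h N; revert N t h; induction r as [|r IHr]; intros N.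
- intros t h; destruct (expands_zeta_sum t h N) as [l [hl hj]].
  exists l; split; [exact hl|]; eapply jet_ext; [|exact hj].
  exists 1%nat; intros b hb; symmetry; apply shifted_sum_0, hb.
- induction N as [|N IHN]; intros t h.
  + exists []; split; [reflexivity | apply shifted_sum_bounded, h].
  + destruct (IHr (S N) (S t) ltac:(lia)) as [l [hl hj]].
    destruct (IHN (S t) ltac:(lia)) as [l' [hl' hj']].
    exists (addl l (0 :: scall (- INR d) l')); split.
    * rewrite addl_length; unfold scall; simpl; rewrite length_map; lia.
    * eapply jet_ext; [|apply (jet_plus _ _ _ _ hj (jet_shift _ _ (jet_scal (- INR d) _ _ hj')))].
      exists 1%nat; intros b hb; pose proof (INR_gt0 b hb).
      rewrite (shifted_sum_rec d r t b hb), !Nat.add_succ_r; cbn [Nat.add pow].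
      set (x := INR b ^ (r + t)); field; lra.
Qed.

Lemma shifted_sum_jet1 d r : forall t, (2 <= r + t)%nat ->
  jet [zeta (INR (r + t))] (fun b => INR b ^ (r + t) * shifted_sum d r t b).
Proof.
induction r as [|r IH]; intros t h.
- eapply jet_ext; [|apply (zeta_sum_jet1 t h)].
  exists 1%nat; intros b hb; symmetry; apply shifted_sum_0, hb.
- pose proof (IH (S t) ltac:(lia)) as h1.
  assert (h2 : jet [] (fun b => INR b ^ (S r + S t) * shifted_sum d (S r) (S t) b))
    by (apply shifted_sum_bounded; lia).
  pose proof (jet_plus _ _ _ _ h1 (jet_shift _ _ (jet_scal (- INR d) _ _ h2))) as h3.
  cbn [addl scall map] in h3; rewrite Rplus_0_r, Nat.add_succ_r in h3.
  eapply jet_ext; [|exact h3].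
  exists 1%nat; intros b hb; pose proof (INR_gt0 b hb).
  rewrite (shifted_sum_rec d r t b hb), !Nat.add_succ_r; cbn [Nat.add pow].
  set (x := INR b ^ (r + t)); field; lra.
Qed.

Lemma shifted_sum_2_jet d :
  jet [zeta 2; -1 - 2 * INR d * zeta 3] (fun b => INR b ^ 2 * shifted_sum d 2 0 b).
Proof.
pose proof (jet_prefix [_; _] [_; _] _ zeta_sum_2_jet) as h0.
pose proof (shifted_sum_jet1 d 1 2 ltac:(lia)) as h1.
pose proof (shifted_sum_jet1 d 2 1 ltac:(lia)) as h2.
change (1 + 2)%nat with 3%nat in *; change (2 + 1)%nat with 3%nat in *.
replace (INR 3) with 3 in * by (simpl; ring).
pose proof (jet_plus _ _ _ _ h0 (jet_shift _ _ (jet_scal (- INR d) _ _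
  (jet_plus _ _ _ _ h1 h2)))) as h.
cbn [addl scall map] in h.
replace (zeta 2 + 0) with (zeta 2) in h by ring.
replace (-1 + - INR d * (zeta 3 + zeta 3)) with (-1 - 2 * INR d * zeta 3) in h by ring.
eapply jet_ext; [|exact h].
exists 1%nat; intros b hb; pose proof (INR_gt0 b hb).
rewrite <- (shifted_sum_0 d 2 b hb), (shifted_sum_rec d 1 0 b hb), (shifted_sum_rec d 0 1 b hb).
field; lra.
Qed.

(** [power_sum p b] is the sum of [a^p] over [0 <= a < b], with [0^0 = 1]. *)
Definition power_sum (p b : nat) : R := rsum b (fun a => INR a ^ p).

Lemma binomial_rsum x y n :
  (x + y) ^ n = rsum (S n) (fun i => Binomial.C n i * x ^ i * y ^ (n - i)).
Proof. rewrite binomial, sum_f_R0_rsum; reflexivity. Qed.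

Lemma C_diag n : Binomial.C n n = 1.
Proof.
unfold Binomial.C; rewrite Nat.sub_diag; simpl; field.
apply not_0_INR, fact_neq_0.
Qed.

Lemma C_pred_diag n : Binomial.C (S n) n = INR (S n).
Proof.
unfold Binomial.C; replace (S n - n)%nat with 1%nat by lia.
rewrite (fact_simpl n), mult_INR; simpl (INR (fact 1)); field.
apply not_0_INR, fact_neq_0.
Qed.

(** Telescoping [(a + 1)^(p+1) - a^(p+1)]. *)
Lemma power_sum_rec p b :
  INR b ^ S p = rsum (S p) (fun j => Binomial.C (S p) j * power_sum j b).
Proof.
induction b as [|b IH].
- simpl (INR 0); rewrite pow_i by lia.
  rewrite (rsum_ext _ _ (fun _ => 0)); [rewrite rsum_const; ring|].
  intros; unfold power_sum; simpl; ring.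
- rewrite S_INR, binomial_rsum; change (rsum (S (S p)) ?f) with (rsum (S p) f + f (S p)).
  cbv beta; rewrite C_diag, Nat.sub_diag, pow_O, Rmult_1_l, Rmult_1_r, IH, <- rsum_plus.
  apply rsum_ext; intros j _; rewrite pow1; unfold power_sum; cbn [rsum]; ring.
Qed.

Lemma expands_power_sum p : expands (fun b => (/ INR b) ^ S p * power_sum p b).
Proof.
induction p as [p IH] using (well_founded_induction lt_wf).
apply (expands_ext (fun b => / INR (S p) * (1 - rsum p (fun j =>
   Binomial.C (S p) j * ((/ INR b) ^ (p - j) * ((/ INR b) ^ S j * power_sum j b)))))).
- exists 1%nat; intros b hb; pose proof (INR_gt0 b hb).
  pose proof (INR_gt0 (S p) ltac:(lia)).
  pose proof (power_sum_rec p b) as e; cbn [rsum] in e; rewrite C_pred_diag in e.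
  rewrite (rsum_ext p _ (fun j => (/ INR b) ^ S p * (Binomial.C (S p) j * power_sum j b))).
  + rewrite rsum_scal.
    replace (power_sum p b) with (/ INR (S p) * (INR b ^ S p -
      rsum p (fun j => Binomial.C (S p) j * power_sum j b))) by (rewrite e; field; lra).
    rewrite (pow_inv (INR b)); field; split; [|apply pow_nonzero]; lra.
  + intros j hj; replace (S p) with ((p - j) + S j)%nat at 2 by lia.
    rewrite pow_add; ring.
- apply expands_mul; [apply expands_const|].
  apply expands_minus; [apply expands_const|].
  apply (expands_rsum p (fun j b => Binomial.C (S p) j *
     ((/ INR b) ^ (p - j) * ((/ INR b) ^ S j * power_sum j b)))); intros j hj.
  apply expands_mul; [apply expands_const|].
  apply expands_mul; [apply expands_pow, expands_inv | apply IH, hj].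
Qed.

Lemma power_sum_0 b : power_sum 0 b = INR b.
Proof. unfold power_sum; simpl; rewrite rsum_const; ring. Qed.

Lemma power_sum_1 b : power_sum 1 b = INR b * (INR b - 1) / 2.
Proof.
induction b as [|b IH]; [unfold power_sum; simpl; field|].
unfold power_sum in *; cbn [rsum]; rewrite IH, S_INR; field.
Qed.

Lemma power_sum_2 b : power_sum 2 b = INR b * (INR b - 1) * (2 * INR b - 1) / 6.
Proof.
induction b as [|b IH]; [unfold power_sum; simpl; field|].
unfold power_sum in *; cbn [rsum]; rewrite IH, S_INR; field.
Qed.

(** * The measure carried by digit strings *)

(** The index [kappa] is one more than the prescribed number of occurrences of [d], and [0]
    stands for an impossible requirement; [branch d kappa a] is the requirement left for the
    rest of a string whose first digit is [a]. *)
Definition branch (d kappa a : nat) : nat := if Nat.eqb a d then Nat.pred kappa else kappa.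

(** The sum of [b^-l f (0.s)], in base [b], over the strings [s] of [l] digits with exactly
    [kappa - 1] occurrences of [d], split according to the first digit of [s]. *)
Fixpoint strsum (b d l kappa : nat) (f : R -> R) : R :=
  match l with
  | O => if Nat.eqb kappa 1 then f 0 else 0
  | S l' => / INR b * rsum b (fun a =>
      strsum b d l' (branch d kappa a) (fun x => f ((INR a + x) / INR b)))
  end.

(** The closed interval; the points of the measure are in [[0, 1)]. *)
Definition unit_itv (x : R) : Prop := 0 <= x <= 1.

Lemma unit_itv_digit b a x : (a < b)%nat -> unit_itv x -> unit_itv ((INR a + x) / INR b).
Proof.
intros ha [h0 h1]; pose proof (INR_gt0 b ltac:(lia)) as hb.
assert (INR a + 1 <= INR b) by (rewrite <- S_INR; apply le_INR; lia).
pose proof (pos_INR a); split.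
- apply Rmult_le_pos; [lra | apply Rlt_le, Rinv_0_lt_compat, hb].
- apply Rmult_le_reg_r with (INR b); [exact hb|].
  replace ((INR a + x) / INR b * INR b) with (INR a + x) by (field; lra); lra.
Qed.

Lemma strsum_ext b d l : forall kappa f g, (forall x, unit_itv x -> f x = g x) ->
  strsum b d l kappa f = strsum b d l kappa g.
Proof.
induction l as [|l IH]; intros kappa f g H; simpl.
- rewrite (H 0) by (split; lra); reflexivity.
- f_equal; apply rsum_ext; intros a ha; apply IH; intros x hx.
  apply H, unit_itv_digit; assumption.
Qed.

Lemma strsum_le b d l : forall kappa f g, (forall x, unit_itv x -> f x <= g x) ->
  strsum b d l kappa f <= strsum b d l kappa g.
Proof.
induction l as [|l IH]; intros kappa f g H; simpl.
- destruct (Nat.eqb kappa 1); [apply H; split; lra | lra].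
- destruct (Nat.eq_dec b 0) as [-> | hb]; [simpl; lra|].
  apply Rmult_le_compat_l; [apply Rlt_le, Rinv_0_lt_compat, INR_gt0; lia|].
  apply rsum_le; intros a ha; apply IH; intros x hx.
  apply H, unit_itv_digit; assumption.
Qed.

Lemma strsum_plus b d l : forall kappa f g,
  strsum b d l kappa (fun x => f x + g x) = strsum b d l kappa f + strsum b d l kappa g.
Proof.
induction l as [|l IH]; intros kappa f g; simpl.
- destruct (Nat.eqb kappa 1); ring.
- rewrite <- Rmult_plus_distr_l, <- rsum_plus; f_equal.
  apply rsum_ext; intros a _.
  apply (IH (branch d kappa a) (fun x => f ((INR a + x) / INR b))
                               (fun x => g ((INR a + x) / INR b))).
Qed.

Lemma strsum_scal b d l : forall kappa c f,
  strsum b d l kappa (fun x => c * f x) = c * strsum b d l kappa f.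
Proof.
induction l as [|l IH]; intros kappa c f; simpl.
- destruct (Nat.eqb kappa 1); ring.
- replace (c * (/ INR b * rsum b (fun a => strsum b d l (branch d kappa a)
      (fun x => f ((INR a + x) / INR b)))))
    with (/ INR b * (c * rsum b (fun a => strsum b d l (branch d kappa a)
      (fun x => f ((INR a + x) / INR b))))) by ring.
  f_equal; rewrite <- rsum_scal; apply rsum_ext; intros a _.
  apply (IH (branch d kappa a) c (fun x => f ((INR a + x) / INR b))).
Qed.

Lemma strsum_kappa0 b d l : forall f, strsum b d l 0 f = 0.
Proof.
induction l as [|l IH]; intros f; simpl; [reflexivity|].
rewrite (rsum_ext _ _ (fun _ => 0)); [rewrite rsum_const; ring|].
intros a _; unfold branch; destruct (Nat.eqb a d); apply IH.
Qed.

Lemma strsum_abs_le b d l kappa f M : (forall x, unit_itv x -> Rabs (f x) <= M) ->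
  Rabs (strsum b d l kappa f) <= M * strsum b d l kappa (fun _ => 1).
Proof.
intros H; apply Rabs_le_between.
replace (M * strsum b d l kappa (fun _ => 1)) with (strsum b d l kappa (fun _ => M)).
- replace (- strsum b d l kappa (fun _ => M)) with (strsum b d l kappa (fun _ => (-1) * M)).
  + split; apply strsum_le; intros x hx; specialize (H x hx); apply Rabs_le_between in H; lra.
  + rewrite (strsum_scal b d l kappa (-1) (fun _ => M)); ring.
- rewrite <- strsum_scal; apply strsum_ext; intros; ring.
Qed.

Lemma strsum_one_nonneg b d l kappa : 0 <= strsum b d l kappa (fun _ => 1).
Proof.
replace 0 with (strsum b d l kappa (fun _ => 0 * 1)).
- apply strsum_le; intros; lra.
- rewrite strsum_scal; ring.
Qed.

(** Isolates the digit [d] in a sum over the first digit. *)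
Lemma rsum_branch b d kappa (F : nat -> nat -> R) : (d < b)%nat ->
  rsum b (fun a => F (branch d kappa a) a)
  = rsum b (fun a => F kappa a) + (F (Nat.pred kappa) d - F kappa d).
Proof.
intros hd.
rewrite <- (rsum_pick b d (fun a => F (Nat.pred kappa) a - F kappa a) hd), <- rsum_plus.
apply rsum_ext; intros a _; unfold branch.
destruct (Nat.eqb_spec a d); ring.
Qed.

Lemma strsum_one_succ b d l kappa : (d < b)%nat ->
  strsum b d (S l) kappa (fun _ => 1)
  = (1 - / INR b) * strsum b d l kappa (fun _ => 1)
    + / INR b * strsum b d l (Nat.pred kappa) (fun _ => 1).
Proof.
intros hd; pose proof (INR_gt0 b ltac:(lia)); cbn [strsum].
rewrite (rsum_branch b d kappa (fun q _ => strsum b d l q (fun _ => 1)) hd), rsum_const.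
field; lra.
Qed.

Lemma ex_series_bounded (a : nat -> R) M :
  (forall n, 0 <= a n) -> (forall n, rsum n a <= M) -> ex_series a.
Proof.
intros h0 hM.
destruct (ex_finite_lim_seq_incr (sum_n a) M) as [L hL].
- intros n; rewrite sum_Sn; unfold plus; simpl; specialize (h0 (S n)); lra.
- intros n; rewrite sum_n_rsum; apply hM.
- exists L; exact hL.
Qed.

(** There are [C(l, kappa - 1) (b - 1)^(l - kappa + 1)] strings of length [l]; rather than
    this formula, the recursion in [l] bounds the partial sums by [b] and determines the
    total mass. *)
Lemma strsum_one_series b d kappa : (d < b)%nat ->
  ex_series (fun l => strsum b d l kappa (fun _ => 1)) /\
  Series (fun l => strsum b d l kappa (fun _ => 1)) = if Nat.eqb kappa 0 then 0 else INR b.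
Proof.
intros hd; pose proof (INR_gt0 b ltac:(lia)) as hb.
assert (hb1 : 1 <= INR b) by (apply (le_INR 1); lia).
assert (hi : 0 < / INR b <= 1).
{ split; [apply Rinv_0_lt_compat, hb | rewrite <- Rinv_1; apply Rinv_le_contravar; lra]. }
set (w := fun q l => strsum b d l q (fun _ : R => 1)).
change (ex_series (w kappa) /\ Series (w kappa) = if Nat.eqb kappa 0 then 0 else INR b).
enough (H : (ex_series (w kappa) /\ Series (w kappa) = if Nat.eqb kappa 0 then 0 else INR b)
  /\ forall L, rsum L (w kappa) <= if Nat.eqb kappa 0 then 0 else INR b) by (apply H).
induction kappa as [|kappa [[IHe IHs] IHb]].
- assert (h0 : forall l, w 0%nat l = 0) by (intros l; apply strsum_kappa0).
  assert (hb0 : forall L, rsum L (w 0%nat) <= 0).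
  { intros L; rewrite (rsum_ext _ _ (fun _ => 0)) by auto; rewrite rsum_const; lra. }
  split; [split|exact hb0].
  + apply (ex_series_bounded _ 0); [intros n; rewrite h0; lra | exact hb0].
  + rewrite (Series_ext _ (fun n => 0 * w 0%nat n)) by (intros n; rewrite h0; ring).
    rewrite Series_scal_l; simpl; ring.
- assert (hrec : forall l, w (S kappa) (S l) = (1 - / INR b) * w (S kappa) l + / INR b * w kappa l).
  { intros l; apply (strsum_one_succ b d l (S kappa) hd). }
  assert (hw0 : w (S kappa) 0%nat = if Nat.eqb kappa 0 then 1 else 0) by reflexivity.
  assert (hbd : forall L, rsum L (w (S kappa)) <= INR b).
  { induction L as [|L IHL]; [simpl; lra|].
    rewrite rsum_first, (rsum_ext _ _ _ (fun i _ => hrec i)), rsum_plus, !rsum_scal, hw0.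
    specialize (IHb L).
    pose proof (Rmult_le_compat_l (1 - / INR b) _ _ ltac:(lra) IHL).
    pose proof (Rmult_le_compat_l (/ INR b) _ _ ltac:(lra) IHb).
    assert (/ INR b * INR b = 1) by (field; lra).
    destruct (Nat.eqb kappa 0); nra. }
  assert (hex : ex_series (w (S kappa))).
  { apply (ex_series_bounded _ (INR b)); [intros n; apply strsum_one_nonneg | exact hbd]. }
  split; [split; [exact hex|] | exact hbd].
  pose proof (Series_incr_1 _ hex) as e.
  rewrite (Series_ext _ _ hrec), Series_plus, !Series_scal_l, IHs, hw0 in e.
  + simpl (Nat.eqb (S kappa) 0); apply Rmult_eq_reg_l with (/ INR b); [|lra].
    assert (/ INR b * INR b = 1) by (field; lra).
    destruct (Nat.eqb kappa 0); lra.
  + apply (ex_series_scal_l (1 - / INR b) (w (S kappa))), hex.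
  + apply (ex_series_scal_l (/ INR b) (w kappa)), IHe.
Qed.

(** [f] is bounded on the unit interval. *)
Definition bounded_on (f : R -> R) : Prop := exists M, forall x, unit_itv x -> Rabs (f x) <= M.

Lemma bounded_on_digit b a f : (a < b)%nat -> bounded_on f ->
  bounded_on (fun x => f ((INR a + x) / INR b)).
Proof. intros ha [M H]; exists M; intros x hx; apply H, unit_itv_digit; assumption. Qed.

Lemma ex_series_strsum b d kappa f : (d < b)%nat -> bounded_on f ->
  ex_series (fun l => strsum b d l kappa f).
Proof.
intros hd [M H].
apply (ex_series_le (V := R_CompleteNormedModule) _ (fun l => M * strsum b d l kappa (fun _ => 1))).
- intros l; apply strsum_abs_le, H.
- apply (ex_series_scal_l M (fun l => strsum b d l kappa (fun _ => 1))).
  apply strsum_one_series, hd.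
Qed.

(** Integration against the measure carried by the strings of all lengths, divided by [b];
    by [mean_one] the total mass is [1] when [kappa >= 1]. *)
Definition mean (b d kappa : nat) (f : R -> R) : R :=
  / INR b * Series (fun l => strsum b d l kappa f).

Lemma mean_kappa0 b d f : mean b d 0 f = 0.
Proof.
unfold mean; rewrite (Series_ext _ (fun n => 0 * strsum b d n 0 f)).
- rewrite Series_scal_l; ring.
- intros n; rewrite strsum_kappa0; ring.
Qed.

Lemma mean_one b d kappa : (d < b)%nat ->
  mean b d kappa (fun _ => 1) = if Nat.eqb kappa 0 then 0 else 1.
Proof.
intros hd; unfold mean; destruct (strsum_one_series b d kappa hd) as [_ ->].
pose proof (INR_gt0 b ltac:(lia)); destruct (Nat.eqb kappa 0); field; lra.
Qed.

Lemma mean_ext b d kappa f g : (forall x, unit_itv x -> f x = g x) ->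
  mean b d kappa f = mean b d kappa g.
Proof.
intros H; unfold mean; f_equal; apply Series_ext; intros l; apply strsum_ext, H.
Qed.

Lemma mean_plus b d kappa f g : (d < b)%nat -> bounded_on f -> bounded_on g ->
  mean b d kappa (fun x => f x + g x) = mean b d kappa f + mean b d kappa g.
Proof.
intros hd hf hg; unfold mean.
rewrite (Series_ext _ _ (fun l => strsum_plus b d l kappa f g)), Series_plus;
  [ring | apply ex_series_strsum; assumption ..].
Qed.

Lemma mean_scal b d kappa c f : mean b d kappa (fun x => c * f x) = c * mean b d kappa f.
Proof.
unfold mean; rewrite (Series_ext _ _ (fun l => strsum_scal b d l kappa c f)), Series_scal_l; ring.
Qed.

Lemma mean_abs_le b d kappa f M : (d < b)%nat -> 0 <= M ->
  (forall x, unit_itv x -> Rabs (f x) <= M) -> Rabs (mean b d kappa f) <= M.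
Proof.
intros hd hM H; unfold mean.
pose proof (INR_gt0 b ltac:(lia)) as hb.
assert (hi : 0 < / INR b) by (apply Rinv_0_lt_compat, hb).
rewrite Rabs_mult, (Rabs_right (/ INR b)) by lra.
destruct (strsum_one_series b d kappa hd) as [he hs].
assert (hM' : ex_series (fun l => M * strsum b d l kappa (fun _ => 1)))
  by (apply (ex_series_scal_l M (fun l => strsum b d l kappa (fun _ => 1))), he).
assert (h : Rabs (Series (fun l => strsum b d l kappa f)) <= M * INR b).
{ eapply Rle_trans; [apply Series_Rabs|].
  - apply (ex_series_le (V := R_CompleteNormedModule) _ (fun l => M * strsum b d l kappa (fun _ => 1))); [|exact hM'].
    intros l; unfold norm; simpl; unfold abs; simpl; rewrite Rabs_Rabsolu.
    apply strsum_abs_le, H.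
  - eapply Rle_trans; [apply Series_le with (b := fun l => M * strsum b d l kappa (fun _ => 1))|].
    + intros l; split; [apply Rabs_pos | apply strsum_abs_le, H].
    + exact hM'.
    + rewrite Series_scal_l, hs; destruct (Nat.eqb kappa 0); nra. }
apply Rmult_le_reg_l with (INR b); [exact hb|].
replace (INR b * (/ INR b * Rabs (Series (fun l => strsum b d l kappa f))))
  with (Rabs (Series (fun l => strsum b d l kappa f))) by (field; lra).
lra.
Qed.

Lemma ex_series_rsum n (u : nat -> nat -> R) : (forall i, (i < n)%nat -> ex_series (u i)) ->
  ex_series (fun l => rsum n (fun i => u i l)) /\
  Series (fun l => rsum n (fun i => u i l)) = rsum n (fun i => Series (u i)).
Proof.
intros H; induction n as [|n IH]; simpl.
- split; [|rewrite (Series_ext _ (fun n => 0 * 0)) by (intros; ring);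
    rewrite Series_scal_l; ring].
  apply (ex_series_bounded _ 0); [intros; lra | intros; rewrite rsum_const; lra].
- destruct IH as [he hs]; [intros; apply H; lia|].
  split; [apply (ex_series_plus (fun l => rsum n (fun i => u i l)) (u n)); [exact he | apply H; lia]|].
  rewrite Series_plus, hs; [reflexivity | exact he | apply H; lia].
Qed.

(** Self-similarity of the measure: removing the first digit. *)
Lemma mean_digit b d kappa f : (d < b)%nat -> bounded_on f ->
  mean b d kappa f = / INR b * ((if Nat.eqb kappa 1 then f 0 else 0)
    + rsum b (fun a => mean b d (branch d kappa a) (fun x => f ((INR a + x) / INR b)))).
Proof.
intros hd hf; unfold mean at 1; f_equal.
rewrite Series_incr_1 by (apply ex_series_strsum; assumption).
f_equal; cbn [strsum]; rewrite Series_scal_l.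
destruct (ex_series_rsum b (fun a l => strsum b d l (branch d kappa a)
   (fun x => f ((INR a + x) / INR b)))) as [_ ->].
- intros a ha; apply ex_series_strsum; [exact hd | apply bounded_on_digit; assumption].
- rewrite <- rsum_scal; reflexivity.
Qed.

(** * Deviation from the Lebesgue measure *)

(** [f] is continuous at every point of the unit interval, on both sides at its ends. *)
Definition cont_on (f : R -> R) : Prop := forall x, unit_itv x -> continuous f x.

Lemma cont_on_bounded f : cont_on f -> bounded_on f.
Proof.
intros hf.
destruct (continuity_ab_maj (fun x => Rabs (f x)) 0 1 ltac:(lra)) as [m [hm _]].
- intros c hc; apply continuity_pt_filterlim.
  apply (continuous_comp f Rabs); [apply hf, hc | apply continuous_Rabs].
- exists (Rabs (f m)); intros x hx; apply hm, hx.
Qed.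

Lemma cont_on_ex_RInt f u v : cont_on f -> unit_itv u -> unit_itv v -> ex_RInt f u v.
Proof.
intros hf [hu hu'] [hv hv']; apply (ex_RInt_continuous (V := R_CompleteNormedModule)); intros z [hz hz']; apply hf.
unfold unit_itv, Rmin, Rmax in *; destruct (Rle_dec u v); lra.
Qed.

Lemma cont_on_digit b a f : (a < b)%nat -> cont_on f ->
  cont_on (fun x => f ((INR a + x) / INR b)).
Proof.
intros ha hf x hx; apply (continuous_comp (fun x => (INR a + x) / INR b) f).
- apply (ex_derive_continuous (fun x => (INR a + x) / INR b)).
  auto_derive; pose proof (INR_gt0 b ltac:(lia)); auto.
- apply hf, unit_itv_digit; assumption.
Qed.

Lemma unit_itv_0 : unit_itv 0. Proof. split; lra. Qed.
Lemma unit_itv_1 : unit_itv 1. Proof. split; lra. Qed.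

Lemma cont_on_ex_RInt01 f : cont_on f -> ex_RInt f 0 1.
Proof. intros hf; apply cont_on_ex_RInt; [exact hf | apply unit_itv_0 | apply unit_itv_1]. Qed.

Lemma RInt_digit b f : (1 <= b)%nat -> cont_on f ->
  RInt f 0 1 = / INR b * rsum b (fun a => RInt (fun x => f ((INR a + x) / INR b)) 0 1).
Proof.
intros hb hf; pose proof (INR_gt0 b hb) as hp.
assert (hu : forall n, (n <= b)%nat -> unit_itv (INR n / INR b)).
{ intros n hn; apply le_INR in hn; pose proof (pos_INR n); split.
  - apply Rmult_le_pos; [lra | apply Rlt_le, Rinv_0_lt_compat, hp].
  - apply Rmult_le_reg_r with (INR b); [exact hp|].
    replace (INR n / INR b * INR b) with (INR n) by (field; lra); lra. }
enough (H : forall n, (n <= b)%nat -> RInt f 0 (INR n / INR b)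
  = / INR b * rsum n (fun a => RInt (fun x => f ((INR a + x) / INR b)) 0 1)).
{ rewrite <- (H b (le_n b)); f_equal; field; lra. }
induction n as [|n IH]; intros hn.
- simpl; replace (0 / INR b) with 0 by (field; lra); rewrite RInt_point; unfold zero; simpl; ring.
- cbn [rsum].
  rewrite <- (RInt_Chasles f 0 (INR n / INR b)).
  + rewrite IH by lia; unfold plus; simpl; rewrite Rmult_plus_distr_l; f_equal.
    assert (e : RInt (fun y => scal (/ INR b) (f (/ INR b * y + INR n / INR b))) 0 1
       = RInt f (INR n / INR b) (INR (S n) / INR b)).
    { pose proof (RInt_comp_lin (V := R_CompleteNormedModule) f (/ INR b) (INR n / INR b) 0 1) as e.
      replace (/ INR b * 0 + INR n / INR b) with (INR n / INR b) in e by ring.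
      replace (/ INR b * 1 + INR n / INR b) with (INR (S n) / INR b) in e
        by (rewrite S_INR; field; lra).
      apply e, cont_on_ex_RInt; [exact hf | apply hu; lia | apply hu; lia]. }
    change (match n with 0%nat => 1 | S _ => INR n + 1 end) with (INR (S n)).
    rewrite <- e.
    transitivity (RInt (fun x => scal (/ INR b) (f ((INR n + x) / INR b))) 0 1).
    * apply RInt_ext; intros x _; unfold scal; simpl; unfold mult; simpl.
      f_equal; f_equal; field; lra.
    * apply (RInt_scal (V := R_CompleteNormedModule) (fun x => f ((INR n + x) / INR b))).
      apply cont_on_ex_RInt01, cont_on_digit; [lia | exact hf].
  + apply cont_on_ex_RInt; [exact hf | apply unit_itv_0 | apply hu; lia].
  + apply cont_on_ex_RInt; [exact hf | apply hu; lia | apply hu; lia].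
Qed.

(** The string measure minus the Lebesgue measure of the unit interval. *)
Definition dev (b d kappa : nat) (f : R -> R) : R := mean b d kappa f - RInt f 0 1.

Lemma dev_ext b d kappa f g : (forall x, unit_itv x -> f x = g x) ->
  dev b d kappa f = dev b d kappa g.
Proof.
intros H; unfold dev; rewrite (mean_ext _ _ _ _ _ H).
rewrite (RInt_ext f g 0 1); [reflexivity|]; intros x; unfold Rmin, Rmax.
destruct (Rle_dec 0 1); [|lra]; intros hx; apply H; split; lra.
Qed.

Lemma dev_plus b d kappa f g : (d < b)%nat -> cont_on f -> cont_on g ->
  dev b d kappa (fun x => f x + g x) = dev b d kappa f + dev b d kappa g.
Proof.
intros hd hf hg; unfold dev.
rewrite mean_plus by (try exact hd; apply cont_on_bounded; assumption).
replace (RInt (fun x => f x + g x) 0 1) with (RInt f 0 1 + RInt g 0 1); [ring|].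
symmetry; apply (RInt_plus (V := R_CompleteNormedModule) f g); apply cont_on_ex_RInt01; assumption.
Qed.

Lemma dev_scal b d kappa c f : cont_on f ->
  dev b d kappa (fun x => c * f x) = c * dev b d kappa f.
Proof.
intros hf; unfold dev; rewrite mean_scal.
replace (RInt (fun x => c * f x) 0 1) with (c * RInt f 0 1); [ring|].
symmetry; apply (RInt_scal (V := R_CompleteNormedModule) f), cont_on_ex_RInt01, hf.
Qed.

Lemma cont_on_const c : cont_on (fun _ => c).
Proof. intros x _; apply continuous_const. Qed.

Lemma cont_on_plus f g : cont_on f -> cont_on g -> cont_on (fun x => f x + g x).
Proof.
intros hf hg x hx; apply (continuous_plus (V := R_NormedModule) f g); [apply hf | apply hg]; exact hx.
Qed.

Lemma cont_on_scal c f : cont_on f -> cont_on (fun x => c * f x).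
Proof. intros hf x hx; apply (continuous_scal_r (V := R_NormedModule) c f); apply hf; exact hx. Qed.

Lemma cont_on_pow m : cont_on (fun x => x ^ m).
Proof. intros x _; apply (ex_derive_continuous (fun x => x ^ m)); auto_derive; auto. Qed.

Lemma cont_on_rsum n (f : nat -> R -> R) : (forall i, (i < n)%nat -> cont_on (f i)) ->
  cont_on (fun x => rsum n (fun i => f i x)).
Proof.
intros H; induction n as [|n IH]; simpl; [apply cont_on_const|].
apply cont_on_plus; [apply IH; intros; apply H; lia | apply H; lia].
Qed.

Lemma dev_const b d kappa c : (d < b)%nat ->
  dev b d kappa (fun _ => c) = if Nat.eqb kappa 0 then - c else 0.
Proof.
intros hd; rewrite (dev_ext _ _ _ _ (fun _ => c * 1)) by (intros; ring).
rewrite dev_scal by (apply cont_on_const); unfold dev.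
rewrite mean_one, RInt_const by exact hd.
unfold scal; simpl; unfold mult; simpl; destruct (Nat.eqb kappa 0); ring.
Qed.

Lemma dev_rsum b d kappa n (f : nat -> R -> R) : (d < b)%nat ->
  (forall i, (i < n)%nat -> cont_on (f i)) ->
  dev b d kappa (fun x => rsum n (fun i => f i x)) = rsum n (fun i => dev b d kappa (f i)).
Proof.
intros hd H; induction n as [|n IH]; simpl.
- rewrite dev_const by exact hd; destruct (Nat.eqb kappa 0); ring.
- rewrite dev_plus; [rewrite IH; [reflexivity|] | exact hd | apply cont_on_rsum |];
    intros; apply H; try lia; assumption.
Qed.

Lemma dev_abs_le b d kappa f M : (d < b)%nat -> 0 <= M -> cont_on f ->
  (forall x, unit_itv x -> Rabs (f x) <= M) -> Rabs (dev b d kappa f) <= 2 * M.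
Proof.
intros hd hM hf H; unfold dev.
pose proof (mean_abs_le b d kappa f M hd hM H) as h1.
pose proof (abs_RInt_le_const f 0 1 M ltac:(lra) (cont_on_ex_RInt01 f hf) H) as h2.
unfold Rminus at 1; eapply Rle_trans; [apply Rabs_triang|]; rewrite Rabs_Ropp; lra.
Qed.

Lemma dev_digit b d kappa f : (d < b)%nat -> cont_on f ->
  dev b d kappa f = / INR b * ((if Nat.eqb kappa 1 then f 0 else 0)
    + rsum b (fun a => dev b d (branch d kappa a) (fun x => f ((INR a + x) / INR b)))).
Proof.
intros hd hf; unfold dev at 1.
rewrite mean_digit by (try exact hd; apply cont_on_bounded, hf).
rewrite (RInt_digit b f) by (try exact hf; lia).
rewrite (rsum_ext b (fun a => mean b d (branch d kappa a) (fun x => f ((INR a + x) / INR b)))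
  (fun a => dev b d (branch d kappa a) (fun x => f ((INR a + x) / INR b))
            + RInt (fun x => f ((INR a + x) / INR b)) 0 1)).
- rewrite rsum_plus; ring.
- intros a _; unfold dev; ring.
Qed.

(** * Moments of the deviation *)

(** For [kappa = 0] these are minus the Lebesgue moments, see [moment_kappa0]. *)
Definition moment (b d kappa m : nat) : R := dev b d kappa (fun x => x ^ m).

Lemma moment_0 b d kappa : (d < b)%nat ->
  moment b d kappa 0 = if Nat.eqb kappa 0 then -1 else 0.
Proof. intros hd; unfold moment; simpl; rewrite dev_const by exact hd; reflexivity. Qed.

Lemma moment_kappa0 b d m : moment b d 0 m = - / INR (S m).
Proof.
unfold moment, dev; rewrite mean_kappa0.
assert (h : is_RInt (fun x => x ^ m) 0 1 (minus (1 ^ S m / INR (S m)) (0 ^ S m / INR (S m)))).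
{ apply (is_RInt_derive (fun x => x ^ S m / INR (S m)) (fun x => x ^ m)).
  - intros x _; auto_derive; [exact I|]; pose proof (INR_gt0 (S m) ltac:(lia)).
    change (match m with 0%nat => 1 | S _ => INR m + 1 end) with (INR (S m)).
    simpl Nat.pred; field; lra.
  - intros x _; apply (ex_derive_continuous (fun x => x ^ m)); auto_derive; auto. }
rewrite (is_RInt_unique _ _ _ _ h), pow1, pow_i by lia.
unfold minus, plus, opp; simpl; unfold Rdiv; ring.
Qed.

Lemma moment_rec b d kappa m : (d < b)%nat -> (1 <= m)%nat ->
  INR b ^ S m * moment b d kappa m = rsum (S m) (fun j => Binomial.C m j *
    (power_sum (m - j) b * moment b d kappa j
     + INR d ^ (m - j) * (moment b d (Nat.pred kappa) j - moment b d kappa j))).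
Proof.
intros hd hm; pose proof (INR_gt0 b ltac:(lia)) as hb.
unfold moment at 1; rewrite (dev_digit b d kappa _ hd (cont_on_pow m)).
rewrite pow_i by lia.
replace (if Nat.eqb kappa 1 then 0 else 0) with 0 by (destruct (Nat.eqb kappa 1); ring).
rewrite Rplus_0_l.
rewrite (rsum_ext b _ (fun a => (/ INR b) ^ m * rsum (S m) (fun j =>
   Binomial.C m j * (INR a ^ (m - j) * moment b d (branch d kappa a) j)))).
- rewrite rsum_scal, rsum_swap.
  replace (INR b ^ S m * (/ INR b * ((/ INR b) ^ m *
     rsum (S m) (fun j => rsum b (fun i => Binomial.C m j *
       (INR i ^ (m - j) * moment b d (branch d kappa i) j))))))
   with (rsum (S m) (fun j => rsum b (fun i => Binomial.C m j *
       (INR i ^ (m - j) * moment b d (branch d kappa i) j)))).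
  2: { rewrite pow_inv; cbn [pow]; field; split; [apply pow_nonzero|]; lra. }
  apply rsum_ext; intros j _; rewrite rsum_scal; f_equal.
  rewrite (rsum_branch b d kappa (fun q a => INR a ^ (m - j) * moment b d q j) hd).
  unfold power_sum; rewrite (Rmult_comm (rsum _ _)), <- rsum_scal.
  rewrite (rsum_ext b (fun a => INR a ^ (m - j) * moment b d kappa j)
     (fun i => moment b d kappa j * INR i ^ (m - j))) by (intros; ring).
  ring.
- intros a ha.
  rewrite (dev_ext _ _ _ _ (fun x => (/ INR b) ^ m * rsum (S m) (fun j =>
     Binomial.C m j * INR a ^ (m - j) * x ^ j))).
  + rewrite dev_scal.
    * f_equal; rewrite dev_rsum; [|exact hd | intros; apply cont_on_scal, cont_on_pow].
      apply rsum_ext; intros j _; rewrite dev_scal by apply cont_on_pow.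
      unfold moment; ring.
    * apply (cont_on_rsum (S m) (fun j x => Binomial.C m j * INR a ^ (m - j) * x ^ j)).
      intros; apply cont_on_scal, cont_on_pow.
  + intros x _; unfold Rdiv; rewrite Rpow_mult_distr, Rplus_comm, binomial_rsum, Rmult_comm.
    f_equal; apply rsum_ext; intros; ring.
Qed.

Lemma inv_taylor y x J : 0 < y -> 0 <= x ->
  / (y + x) = (/ y + rsum J (fun i => (-1) ^ S i * (/ y) ^ (i + 2) * x ^ S i))
    + (-1) ^ S J * ((/ y) ^ S J * (x ^ S J * / (y + x))).
Proof.
intros hy hx; induction J as [|J IH]; [simpl; field; lra|].
rewrite IH at 1; cbn [rsum]; replace (J + 2)%nat with (S (S J)) by lia; cbn [pow].
set (u := (/ y) ^ J); set (v := x ^ J); set (w := (-1) ^ J); field; lra.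
Qed.

(** Since constants have deviation zero when [kappa >= 1], Taylor's formula expresses the
    deviation of [1 / (n + x)] through moments, with an error of the order of the remainder. *)
Lemma dev_inv_taylor b d kappa n J : (d < b)%nat -> (1 <= kappa)%nat -> (1 <= n)%nat ->
  Rabs (dev b d kappa (fun x => / (INR n + x))
        - rsum J (fun i => (-1) ^ S i * (/ INR n) ^ (i + 2) * moment b d kappa (S i)))
  <= 2 * (/ INR n) ^ (J + 2).
Proof.
intros hd hk hn; pose proof (INR_gt0 n hn) as hp.
set (rem := fun x => (-1) ^ S J * ((/ INR n) ^ S J * (x ^ S J * / (INR n + x)))).
set (tm := fun i x => ((-1) ^ S i * (/ INR n) ^ (i + 2)) * x ^ S i).
assert (hc : cont_on rem).
{ intros x [hx _]; apply (ex_derive_continuous rem); unfold rem; auto_derive; lra. }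
assert (ht : forall i, cont_on (tm i)) by (intros i; apply cont_on_scal, cont_on_pow).
assert (hs : cont_on (fun x => rsum J (fun i => tm i x))) by (apply cont_on_rsum; auto).
rewrite (dev_ext _ _ _ _ (fun x => (/ INR n + rsum J (fun i => tm i x)) + rem x)).
- rewrite dev_plus; [|exact hd | apply cont_on_plus; [apply cont_on_const | exact hs] | exact hc].
  rewrite dev_plus; [|exact hd | apply cont_on_const | exact hs].
  rewrite dev_const by exact hd; rewrite dev_rsum; [|exact hd | auto].
  rewrite (proj2 (Nat.eqb_neq kappa 0)) by lia.
  rewrite (rsum_ext J (fun i => dev b d kappa (tm i))
     (fun i => (-1) ^ S i * (/ INR n) ^ (i + 2) * moment b d kappa (S i))).
  + match goal with |- Rabs ?e <= _ => replace e with (dev b d kappa rem) by ring end.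
    assert (hi : 0 < / INR n) by (apply Rinv_0_lt_compat, hp).
    apply dev_abs_le; [exact hd | apply pow_le; lra | exact hc|].
    intros x [hx hx1]; unfold rem; rewrite !Rabs_mult, pow_1_abs, Rmult_1_l.
    rewrite !Rabs_right; try (apply Rle_ge, pow_le; lra).
    2: apply Rle_ge, Rlt_le, Rinv_0_lt_compat; lra.
    replace (J + 2)%nat with (S J + 1)%nat by lia; rewrite pow_add, pow_1.
    apply Rmult_le_compat_l; [apply pow_le; lra|].
    rewrite <- (Rmult_1_l (/ INR n)); apply Rmult_le_compat.
    * apply pow_le; lra.
    * apply Rlt_le, Rinv_0_lt_compat; lra.
    * rewrite <- (pow1 (S J)); apply pow_incr; lra.
    * apply Rinv_le_contravar; lra.
  + intros i _; unfold tm; rewrite dev_scal by apply cont_on_pow; reflexivity.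
- intros x [hx _]; apply inv_taylor; assumption.
Qed.

(** * Irwin sums as integrals *)

(** Occurrences of [d] among the last [l] digits of [n], padded with zeros if necessary. *)
Fixpoint padded_count (b d l n : nat) : nat :=
  match l with
  | O => 0
  | S l' => ((if Nat.eqb (n mod b) d then 1 else 0) + padded_count b d l' (n / b))%nat
  end.

Lemma digits_fuel_count b d l : (2 <= b)%nat -> forall fuel n,
  (b ^ l <= n < b ^ S l)%nat -> (n <= fuel)%nat ->
  count_occ Nat.eq_dec (digits_fuel fuel b n) d = padded_count b d (S l) n.
Proof.
intros hb; induction l as [|l IH]; intros fuel n [hn hn'] hf.
- simpl in hn, hn'; destruct fuel as [|fuel]; [lia|].
  assert (e : (n / b = 0)%nat) by (apply Nat.div_small; lia).
  simpl; rewrite e; destruct (Nat.eqb_spec n 0); [lia|].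
  destruct (Nat.eq_dec (n mod b) d) as [e'|e'];
    [rewrite (proj2 (Nat.eqb_eq _ _) e') | rewrite (proj2 (Nat.eqb_neq _ _) e')];
    cbn [count_occ]; destruct (Nat.eq_dec (n mod b) d); try contradiction;
    destruct fuel; reflexivity.
- assert (hp : (0 < b ^ l)%nat) by (apply Nat.neq_0_lt_0, Nat.pow_nonzero; lia).
  assert (h0 : (0 < n)%nat) by (simpl in hn; nia).
  destruct fuel as [|fuel]; [lia|].
  assert (hd : (n / b < n)%nat) by (apply Nat.div_lt; lia).
  assert (h1 : (b ^ l <= n / b)%nat) by (apply Nat.div_le_lower_bound; simpl in hn; lia).
  assert (h2 : (n / b < b ^ S l)%nat) by (apply Nat.Div0.div_lt_upper_bound; exact hn').
  pose proof (IH fuel (n / b)%nat (conj h1 h2) ltac:(lia)) as e.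
  cbn [digits_fuel]; destruct (Nat.eqb_spec n 0); [lia|].
  change (padded_count b d (S (S l)) n) with
    ((if Nat.eqb (n mod b) d then 1 else 0) + padded_count b d (S l) (n / b))%nat.
  rewrite <- e; cbn [count_occ].
  destruct (Nat.eq_dec (n mod b) d) as [e'|e'];
    [rewrite (proj2 (Nat.eqb_eq _ _) e') | rewrite (proj2 (Nat.eqb_neq _ _) e')]; reflexivity.
Qed.

Lemma padded_count_lead b d l : (2 <= b)%nat -> forall c n,
  (c < b)%nat -> (n < b ^ l)%nat ->
  padded_count b d (S l) (c * b ^ l + n)
  = ((if Nat.eqb c d then 1 else 0) + padded_count b d l n)%nat.
Proof.
intros hb; induction l as [|l IH]; intros c n hc hn.
- simpl in hn; assert (n = 0)%nat as -> by lia; simpl.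
  rewrite Nat.mul_1_r, !Nat.add_0_r, Nat.mod_small by exact hc; reflexivity.
- change (padded_count b d (S (S l)) (c * b ^ S l + n)) with
    ((if Nat.eqb ((c * b ^ S l + n) mod b) d then 1 else 0)
     + padded_count b d (S l) ((c * b ^ S l + n) / b))%nat.
  replace (c * b ^ S l + n)%nat with (n + (c * b ^ l) * b)%nat by (simpl; ring).
  rewrite Nat.Div0.mod_add, Nat.div_add by lia.
  rewrite (Nat.add_comm (n / b)), IH.
  + cbn [padded_count]; lia.
  + exact hc.
  + apply Nat.Div0.div_lt_upper_bound; exact hn.
Qed.

(** [strsum] as a plain sum over the integers [n < b^l], read as strings of [l] digits. *)
Lemma strsum_padded b d l : (2 <= b)%nat -> forall kappa f,
  strsum b d l kappa f = (/ INR b) ^ l * rsum (b ^ l) (fun n =>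
    if Nat.eqb (S (padded_count b d l n)) kappa then f (INR n / INR b ^ l) else 0).
Proof.
intros hb; pose proof (INR_gt0 b ltac:(lia)) as hp.
induction l as [|l IH]; intros kappa f.
- destruct kappa as [|[|kappa]]; simpl; [ring | | ring].
  unfold Rdiv; rewrite Rmult_0_l; ring.
- cbn [strsum]; replace (b ^ S l)%nat with (b * b ^ l)%nat by reflexivity.
  rewrite rsum_mul.
  cbn [pow]; rewrite Rmult_assoc; f_equal; rewrite <- rsum_scal.
  apply rsum_ext; intros c hc; rewrite IH; f_equal; apply rsum_ext; intros n hn.
  rewrite padded_count_lead by assumption.
  replace ((INR c + INR n / INR b ^ l) / INR b) with (INR (c * b ^ l + n) / (INR b * INR b ^ l)).
  2: { rewrite plus_INR, mult_INR, pow_INR; field; split; try apply pow_nonzero; lra. }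
  unfold branch; destruct (Nat.eqb_spec c d) as [-> | hne]; [|reflexivity].
  destruct kappa as [|kappa]; reflexivity.
Qed.

Lemma cont_on_inv y : 0 < y -> cont_on (fun x => / (y + x)).
Proof.
intros hy x [hx _]; apply (ex_derive_continuous (fun x => / (y + x))); auto_derive; lra.
Qed.

Lemma is_series_rsum_lim (a : nat -> R) : ex_series a ->
  is_lim_seq (fun n => rsum (S n) a) (Series a).
Proof.
intros h; apply Series_correct in h.
apply (is_lim_seq_ext (sum_n a)); [intros; apply sum_n_rsum | exact h].
Qed.

Lemma rsum_nonneg_le (a : nat -> R) m n : (forall i, 0 <= a i) -> (m <= n)%nat ->
  rsum m a <= rsum n a.
Proof.
intros h hmn; replace n with (m + (n - m))%nat by lia; rewrite rsum_app.
pose proof (rsum_nonneg (n - m) (fun i => a (m + i)%nat) (fun i _ => h _)); lra.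
Qed.

Lemma pow_gt_index b n : (2 <= b)%nat -> (n < b ^ n)%nat.
Proof. intros hb; apply Nat.pow_gt_lin_r; lia. Qed.

(** A nonnegative series may be summed along blocks. *)
Lemma Series_blocks b (a G : nat -> R) : (2 <= b)%nat -> (forall i, 0 <= a i) ->
  ex_series G -> (forall i, 0 <= G i) ->
  (forall L, rsum (b ^ L - 1) a = rsum L G) -> Series a = Series G.
Proof.
intros hb ha hG hG0 e.
pose proof (is_series_rsum_lim G hG) as hl.
assert (hbd : forall n, rsum n G <= Series G).
{ intros n; apply Rle_trans with (rsum (S n) G); [apply rsum_nonneg_le; [exact hG0 | lia]|].
  apply (is_lim_seq_incr_compare _ _ hl); intros m; apply rsum_nonneg_le; [exact hG0 | lia]. }
assert (hex : ex_series a).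
{ apply (ex_series_bounded a (Series G) ha); intros n.
  eapply Rle_trans; [apply (rsum_nonneg_le a n (b ^ n - 1) ha);
    pose proof (pow_gt_index b n hb); lia|].
  rewrite e; apply hbd. }
pose proof (is_series_rsum_lim a hex) as hla.
assert (hphi : filterlim (fun L => (b ^ S L - 2)%nat) eventually eventually).
{ intros P [N HP]; exists N; intros n hn; apply HP.
  pose proof (pow_gt_index b (S n) hb); lia. }
pose proof (is_lim_seq_subseq _ _ _ hphi hla) as h1.
apply (is_lim_seq_ext _ (fun n => rsum (S n) G)) in h1.
- apply is_lim_seq_unique in h1; apply is_lim_seq_unique in hl.
  rewrite hl in h1; injection h1 as h1; symmetry; exact h1.
- intros n; rewrite <- e; f_equal; pose proof (pow_gt_index b (S n) hb); lia.
Qed.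

Lemma irwin_sum_mean b d k : (2 <= b)%nat -> (d < b)%nat ->
  irwin_sum b d k = INR b * rsum (Nat.pred b) (fun i =>
    mean b d (branch d (S k) (S i)) (fun x => / (INR (S i) + x))).
Proof.
intros hb hd; pose proof (INR_gt0 b ltac:(lia)) as hp.
set (G := fun l => rsum (Nat.pred b) (fun i =>
   strsum b d l (branch d (S k) (S i)) (fun x => / (INR (S i) + x)))).
destruct (ex_series_rsum (Nat.pred b) (fun i l =>
   strsum b d l (branch d (S k) (S i)) (fun x => / (INR (S i) + x)))) as [he hs].
{ intros i _; apply ex_series_strsum; [exact hd|].
  apply cont_on_bounded, cont_on_inv, INR_gt0; lia. }
unfold irwin_sum.
set (T := fun m => if Nat.eqb (digit_count b d m) k then / INR m else 0).
match goal with |- _ = ?r => change (Series (fun n => T (S n)) = r) end.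
rewrite (Series_blocks b (fun n => T (S n)) G hb).
- unfold G; rewrite hs, <- rsum_scal; apply rsum_ext; intros i _; unfold mean; field; lra.
- intros i; unfold T; destruct (Nat.eqb (digit_count b d (S i)) k); [|lra].
  apply Rlt_le, Rinv_0_lt_compat, INR_gt0; lia.
- exact he.
- intros l; apply rsum_nonneg; intros i _.
  replace 0 with (strsum b d l (branch d (S k) (S i)) (fun x => 0 * 1))
    by (rewrite strsum_scal; ring).
  apply strsum_le; intros x [hx _]; rewrite Rmult_0_l.
  apply Rlt_le, Rinv_0_lt_compat; pose proof (INR_gt0 (S i) ltac:(lia)); lra.
- assert (T0 : T 0%nat = 0).
  { unfold T; simpl (INR 0); rewrite Rinv_0; destruct (Nat.eqb _ _); reflexivity. }
  intros L.
  replace (rsum (b ^ L - 1) (fun n => T (S n))) with (rsum (b ^ L) T).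
  2: { pose proof (pow_gt_index b L hb).
       replace (b ^ L)%nat with (S (b ^ L - 1)) at 1 by lia.
       rewrite rsum_first, T0; ring. }
  induction L as [|L IH]; [simpl; rewrite T0; ring|].
  replace (b ^ S L)%nat with (b * b ^ L)%nat by reflexivity; rewrite rsum_mul.
  replace b with (S (Nat.pred b)) at 1 by lia.
  rewrite rsum_first; cbn [Nat.mul Nat.add rsum].
  rewrite <- IH; f_equal.
  unfold G; apply rsum_ext; intros i hi.
  rewrite strsum_padded, <- rsum_scal by exact hb.
  apply rsum_ext; intros n hn.
  assert (hpow : 0 < INR b ^ L) by (apply pow_lt, hp).
  assert (hq : (0 < b ^ L)%nat) by (apply Nat.neq_0_lt_0, Nat.pow_nonzero; lia).
  unfold T, digit_count, digits.
  change (b ^ L + i * b ^ L)%nat with (S i * b ^ L)%nat.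
  rewrite (digits_fuel_count b d L hb); [| |lia].
  2: { split; [nia|].
       replace (b ^ S L)%nat with (b * b ^ L)%nat by reflexivity; nia. }
  rewrite padded_count_lead by (try assumption; lia).
  replace (/ INR (S i * b ^ L + n)) with ((/ INR b) ^ L * / (INR (S i) + INR n / INR b ^ L)).
  2: { rewrite plus_INR, mult_INR, pow_INR, pow_inv.
       pose proof (INR_gt0 (S i) ltac:(lia)); pose proof (pos_INR n); field; nra. }
  unfold branch; destruct (Nat.eqb_spec (S i) d) as [e | hne].
  + cbn [Nat.pred]; change (1 + padded_count b d L n)%nat with (S (padded_count b d L n)).
    destruct (Nat.eqb (S (padded_count b d L n)) k); ring.
  + change (0 + padded_count b d L n)%nat with (padded_count b d L n).
    change (Nat.eqb (S (padded_count b d L n)) (S k)) with (Nat.eqb (padded_count b d L n) k).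
    destruct (Nat.eqb (padded_count b d L n) k); ring.
Qed.

Lemma RInt_inv_shift y : 0 < y -> RInt (fun x => / (y + x)) 0 1 = ln (y + 1) - ln y.
Proof.
intros hy; apply is_RInt_unique.
replace (ln (y + 1) - ln y) with (minus (ln (y + 1)) (ln (y + 0)))
  by (rewrite Rplus_0_r; reflexivity).
apply (is_RInt_derive (fun x => ln (y + x)) (fun x => / (y + x))).
- intros x; unfold Rmin, Rmax; destruct (Rle_dec 0 1); [|lra]; intros hx.
  auto_derive; [lra | field; lra].
- intros x; unfold Rmin, Rmax; destruct (Rle_dec 0 1); [|lra]; intros hx.
  apply cont_on_inv; assumption.
Qed.

Lemma ln_rsum b : (1 <= b)%nat ->
  ln (INR b) = rsum (Nat.pred b) (fun i => RInt (fun x => / (INR (S i) + x)) 0 1).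
Proof.
intros hb; destruct b as [|b]; [lia|]; clear hb; simpl Nat.pred.
induction b as [|b IH]; [simpl; apply ln_1|].
cbn [rsum]; rewrite <- IH, RInt_inv_shift by (apply INR_gt0; lia).
rewrite (S_INR (S b)); ring.
Qed.

Lemma irwin_sum_dev b d k : (2 <= b)%nat -> (d < b)%nat ->
  irwin_sum b d k - INR b * ln (INR b) = INR b * rsum (Nat.pred b) (fun i =>
    dev b d (branch d (S k) (S i)) (fun x => / (INR (S i) + x))).
Proof.
intros hb hd; rewrite irwin_sum_mean, ln_rsum by (try assumption; lia).
rewrite <- Rmult_minus_distr_l; f_equal.
unfold Rminus.
replace (- rsum (Nat.pred b) (fun i => RInt (fun x => / (INR (S i) + x)) 0 1))
  with ((-1) * rsum (Nat.pred b) (fun i => RInt (fun x => / (INR (S i) + x)) 0 1)) by ring.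
rewrite <- rsum_scal, <- rsum_plus; apply rsum_ext; intros i _; unfold dev; ring.
Qed.

Lemma branch_ge d kappa a : (Nat.pred kappa <= branch d kappa a)%nat.
Proof. unfold branch; destruct (Nat.eqb a d); lia. Qed.

(** The same with the two leading digits removed: the integers [n] below have two digits. *)
Lemma irwin_sum_dev2 b d k : (2 <= b)%nat -> (d < b)%nat -> (2 <= k)%nat ->
  irwin_sum b d k - INR b * ln (INR b) = INR b * rsum (Nat.pred b) (fun i => rsum b (fun a =>
    dev b d (branch d (branch d (S k) (S i)) a) (fun x => / (INR (S i * b + a) + x)))).
Proof.
intros hb hd hk; rewrite irwin_sum_dev by assumption; f_equal.
pose proof (INR_gt0 b ltac:(lia)) as hp.
apply rsum_ext; intros i _; pose proof (INR_gt0 (S i) ltac:(lia)) as hi.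
rewrite dev_digit by (try exact hd; apply cont_on_inv, hi).
rewrite (proj2 (Nat.eqb_neq (branch d (S k) (S i)) 1))
  by (pose proof (branch_ge d (S k) (S i)); lia).
rewrite Rplus_0_l, <- rsum_scal; apply rsum_ext; intros a ha.
rewrite <- dev_scal by (apply (cont_on_digit b a (fun x => / (INR (S i) + x)) ha), cont_on_inv, hi).
apply dev_ext; intros x [hx _]; rewrite plus_INR, mult_INR.
pose proof (pos_INR a); field; nra.
Qed.

(** Summation over two-digit integers [c b + a] of a weight that depends only on the
    number of digits equal to [d]. *)
Lemma rsum_two_digits b d K (phi V : nat -> R) : (1 <= d < b)%nat ->
  rsum (Nat.pred b) (fun i => rsum b (fun a =>
    phi (S i * b + a)%nat * V (branch d (branch d K (S i)) a)))
  = V K * rsum (Nat.pred b) (fun i => rsum b (fun a => phi (S i * b + a)%nat))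
    + (V (Nat.pred K) - V K) *
      (rsum b (fun a => phi (d * b + a)%nat)
       + rsum (Nat.pred b) (fun i => phi (S i * b + d)%nat))
    + (V (Nat.pred (Nat.pred K)) - 2 * V (Nat.pred K) + V K) * phi (d * b + d)%nat.
Proof.
intros [h1 hd].
set (F := fun q i => rsum b (fun a => phi (S i * b + a)%nat) * V q
   + phi (S i * b + d)%nat * (V (Nat.pred q) - V q)).
rewrite (rsum_ext _ _ (fun i => F (branch (Nat.pred d) K i) i)).
- rewrite rsum_branch by lia; unfold F; replace (S (Nat.pred d)) with d by lia.
  rewrite rsum_plus.
  rewrite (rsum_ext _ (fun i => rsum b (fun a => phi (S i * b + a)%nat) * V K)
    (fun i => V K * rsum b (fun a => phi (S i * b + a)%nat))) by (intros; ring).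
  rewrite (rsum_ext _ (fun i => phi (S i * b + d)%nat * (V (Nat.pred K) - V K))
    (fun i => (V (Nat.pred K) - V K) * phi (S i * b + d)%nat)) by (intros; ring).
  rewrite !rsum_scal; ring.
- intros i _.
  replace (branch (Nat.pred d) K i) with (branch d K (S i)).
  2: { unfold branch; destruct (Nat.eqb_spec (S i) d), (Nat.eqb_spec i (Nat.pred d));
       reflexivity || lia. }
  set (q := branch d K (S i)).
  rewrite (rsum_branch b d q (fun q a => phi (S i * b + a)%nat * V q) hd).
  unfold F; rewrite (rsum_ext _ (fun a => phi (S i * b + a)%nat * V q)
    (fun a => V q * phi (S i * b + a)%nat)) by (intros; ring).
  rewrite rsum_scal; ring.
Qed.

(** The contribution of the moments of order [j + 1]: the three terms sum [n^-(j+2)] over all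
    two-digit integers [n], over those with a digit [d] counted with multiplicity, and at
    [n = d b + d]. The coefficients follow by inclusion and exclusion, as the moment
    that goes with [n] has index [k + 1] minus the number of digits [d] of [n]. *)
Definition moment_term (b d k j : nat) : R :=
  moment b d (S k) (S j) * (zeta_sum (j + 2) (b * b) - zeta_sum (j + 2) b)
  + (moment b d k (S j) - moment b d (S k) (S j))
    * (zeta_sum (j + 2) (S d * b) - zeta_sum (j + 2) (d * b) + shifted_sum d (j + 2) 0 b)
  + (moment b d (Nat.pred k) (S j) - 2 * moment b d k (S j) + moment b d (S k) (S j))
    * (/ INR (d * b + d)) ^ (j + 2).

Lemma rsum_inv_pow_two_digits b d k j : (1 <= d < b)%nat ->
  rsum (Nat.pred b) (fun i => rsum b (fun a => (/ INR (S i * b + a)) ^ (j + 2)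
     * moment b d (branch d (branch d (S k) (S i)) a) (S j))) = moment_term b d k j.
Proof.
intros hd.
rewrite (rsum_two_digits b d (S k) (fun n => (/ INR n) ^ (j + 2))
   (fun q => moment b d q (S j)) hd).
unfold moment_term; cbn [Nat.pred]; f_equal; f_equal.
- f_equal; replace (b * b)%nat with (b + Nat.pred b * b)%nat by nia.
  rewrite zeta_sum_range, rsum_mul by lia.
  apply rsum_ext; intros i _; apply rsum_ext; intros a _; do 3 f_equal; lia.
- f_equal; f_equal.
  + replace (S d * b)%nat with (d * b + b)%nat by lia.
    rewrite zeta_sum_range by nia; reflexivity.
  + unfold shifted_sum; apply rsum_ext; intros i _; rewrite plus_INR, mult_INR; simpl; ring.
Qed.

Lemma irwin_sum_approx b d k J : (1 <= d < b)%nat -> (2 <= k)%nat ->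
  Rabs (irwin_sum b d k - INR b * ln (INR b)
        - INR b * rsum J (fun j => (-1) ^ S j * moment_term b d k j))
  <= 2 * INR b ^ 3 * (/ INR b) ^ (J + 2).
Proof.
intros hd hk; pose proof (INR_gt0 b ltac:(lia)) as hp.
rewrite irwin_sum_dev2 by lia; rewrite <- Rmult_minus_distr_l, Rabs_mult, (Rabs_right (INR b)) by lra.
replace (2 * INR b ^ 3 * (/ INR b) ^ (J + 2))
  with (INR b * (INR b * (INR b * (2 * (/ INR b) ^ (J + 2))))) by ring.
apply Rmult_le_compat_l; [lra|].
rewrite (rsum_ext J _ (fun j => rsum (Nat.pred b) (fun i => rsum b (fun a =>
   (-1) ^ S j * (/ INR (S i * b + a)) ^ (j + 2)
   * moment b d (branch d (branch d (S k) (S i)) a) (S j))))).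
2: { intros j _; rewrite <- rsum_inv_pow_two_digits by exact hd; rewrite <- rsum_scal.
     apply rsum_ext; intros i _; rewrite <- rsum_scal; apply rsum_ext; intros; ring. }
rewrite (rsum_swap J).
assert (hsub : forall n f g, rsum n f - rsum n g = rsum n (fun i => f i - g i)).
{ intros n f g; induction n as [|n IH]; simpl; [ring | rewrite <- IH; ring]. }
assert (hi : 0 < / INR b) by (apply Rinv_0_lt_compat, hp).
assert (hr : 0 <= 2 * (/ INR b) ^ (J + 2)) by (pose proof (pow_le _ (J + 2) (Rlt_le _ _ hi)); lra).
rewrite hsub; eapply Rle_trans; [apply rsum_abs|].
apply Rle_trans with (rsum (Nat.pred b) (fun _ => INR b * (2 * (/ INR b) ^ (J + 2)))).
- apply rsum_le; intros i _; rewrite (rsum_swap J), hsub.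
  eapply Rle_trans; [apply rsum_abs|].
  rewrite <- (rsum_const b); apply rsum_le; intros a _.
  eapply Rle_trans; [apply dev_inv_taylor; [lia | | nia]|].
  + pose proof (branch_ge d (S k) (S i)); pose proof (branch_ge d (branch d (S k) (S i)) a); lia.
  + apply Rmult_le_compat_l; [lra|]; apply pow_incr; split.
    * apply Rlt_le, Rinv_0_lt_compat, INR_gt0; nia.
    * apply Rinv_le_contravar; [exact hp | apply le_INR; nia].
- rewrite rsum_const; apply Rmult_le_compat_r; [nra | apply le_INR; lia].
Qed.

(** * Expansions of the moments *)

(** Reduces [expands] of an arithmetic expression to its atoms. *)
Ltac expands_tac := repeat lazymatch goal with
  | |- expands (fun b => @?f b + @?g b) => apply (expands_plus f g)
  | |- expands (fun b => @?f b - @?g b) => apply (expands_minus f g)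
  | |- expands (fun b => (@?f b) ^ ?n) => apply (expands_pow f n)
  | |- expands (fun b => (/ INR b) ^ S ?q * power_sum ?q b) => apply expands_power_sum
  | |- expands (fun _ => ?c) => apply expands_const
  | |- expands (fun b => @?f b * @?g b) => apply (expands_mul f g)
  | |- expands (fun b => / INR b) => apply expands_inv
  end.

(** The moments are [O(b^(-2 kappa))]; [d], [kappa] and [m] being fixed, this is the scaled
    moment as a function of [b]. *)
Definition scaled_moment (d kappa m b : nat) : R := INR b ^ (2 * kappa) * moment b d kappa m.

Lemma scaled_moment_0 d kappa b : (d < b)%nat -> scaled_moment d (S kappa) 0 b = 0.
Proof. intros hd; unfold scaled_moment; rewrite moment_0 by exact hd; simpl; ring. Qed.

Lemma scaled_moment_kappa0 d m b : scaled_moment d 0 m b = - / INR (S m).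
Proof. unfold scaled_moment; rewrite moment_kappa0, Nat.mul_0_r, pow_O; ring. Qed.

Lemma scaled_moment_rec d kappa m b : (d < b)%nat -> (1 <= m)%nat ->
  INR b ^ S m * scaled_moment d (S kappa) m b = rsum (S m) (fun j => Binomial.C m j *
    ((power_sum (m - j) b - INR d ^ (m - j)) * scaled_moment d (S kappa) j b
     + INR d ^ (m - j) * INR b ^ 2 * scaled_moment d kappa j b)).
Proof.
intros hd hm; unfold scaled_moment.
replace (INR b ^ S m * (INR b ^ (2 * S kappa) * moment b d (S kappa) m))
  with (INR b ^ (2 * S kappa) * (INR b ^ S m * moment b d (S kappa) m)) by ring.
rewrite moment_rec by assumption; rewrite <- rsum_scal; apply rsum_ext; intros j _.
replace (2 * S kappa)%nat with (2 + 2 * kappa)%nat by lia; rewrite pow_add; cbn [Nat.pred]; ring.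
Qed.

(** The recursion solved for the moment of highest order and divided by [b^(p+2)]: all coefficients
    now are expansions in [1 / b]. *)
Lemma scaled_moment_solve d kappa p b : (d < b)%nat ->
  scaled_moment d (S kappa) (S p) b
  = / (1 + ((/ INR b) ^ S p - (/ INR b) ^ p) / INR b) *
    ((/ INR b) ^ p * scaled_moment d kappa (S p) b
     + rsum (S p) (fun j => Binomial.C (S p) j *
        ((/ INR b) ^ j * ((/ INR b) ^ S (S p - j) * power_sum (S p - j) b)
           * scaled_moment d (S kappa) j b
         - INR d ^ (S p - j) * (/ INR b) ^ S (S p) * scaled_moment d (S kappa) j b
         + INR d ^ (S p - j) * (/ INR b) ^ p * scaled_moment d kappa j b))).
Proof.
intros hd; pose proof (INR_gt0 b ltac:(lia)) as hp.
pose proof (scaled_moment_rec d kappa (S p) b hd ltac:(lia)) as e.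
change (rsum (S (S p)) ?f) with (rsum (S p) f + f (S p)) in e; cbv beta in e.
rewrite C_diag, Nat.sub_diag, power_sum_0, !pow_O in e.
set (W := scaled_moment d (S kappa) (S p) b) in *.
rewrite (rsum_ext (S p) _ (fun j => (/ INR b) ^ S (S p) * (Binomial.C (S p) j *
    ((power_sum (S p - j) b - INR d ^ (S p - j)) * scaled_moment d (S kappa) j b
     + INR d ^ (S p - j) * INR b ^ 2 * scaled_moment d kappa j b)))).
- rewrite rsum_scal.
  set (Z := rsum (S p) _) in *.
  assert (hnz : 1 + ((/ INR b) ^ S p - (/ INR b) ^ p) / INR b <> 0).
  { assert (h1 : 0 < / INR b <= 1).
    { split; [apply Rinv_0_lt_compat, hp|].
      rewrite <- Rinv_1; apply Rinv_le_contravar; [lra | apply (le_INR 1); lia]. }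
    assert (h2 : 0 < (/ INR b) ^ S p) by (apply pow_lt; lra).
    assert (h3 : (/ INR b) ^ p <= 1) by (rewrite <- (pow1 p); apply pow_incr; lra).
    assert (0 <= (/ INR b) ^ p) by (apply pow_le; lra).
    unfold Rdiv; nra. }
  apply Rmult_eq_reg_l with (1 + ((/ INR b) ^ S p - (/ INR b) ^ p) / INR b); [|exact hnz].
  rewrite <- Rmult_assoc, Rinv_r, Rmult_1_l by exact hnz.
  replace Z with (INR b ^ S (S p) * W -
    (1 * ((INR b - 1) * W + 1 * INR b ^ 2 * scaled_moment d kappa (S p) b))) by (rewrite e; ring).
  rewrite !pow_inv; cbn [pow]; field; split; [apply pow_nonzero|]; lra.
- intros j hj; replace (S (S p)) with (j + S (S p - j))%nat at 2 by lia.
  rewrite pow_add.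
  replace ((/ INR b) ^ p) with ((/ INR b) ^ S (S p) * INR b ^ 2)
    by (cbn [pow]; field; lra).
  replace ((/ INR b) ^ S (S p)) with ((/ INR b) ^ j * (/ INR b) ^ S (S p - j))
    by (rewrite <- pow_add; f_equal; lia).
  ring.
Qed.

Lemma expands_denominator p : expands (fun b => / (1 + ((/ INR b) ^ S p - (/ INR b) ^ p) / INR b)).
Proof.
apply (expands_inv_denominator (fun b => (/ INR b) ^ S p - (/ INR b) ^ p)).
apply expands_minus; apply expands_pow, expands_inv.
Qed.

Lemma expands_scaled_moment d kappa : forall m, expands (scaled_moment d kappa m).
Proof.
induction kappa as [|kappa IHk]; intros m.
- apply (expands_ext (fun _ => - / INR (S m))); [|apply expands_const].
  exists 0%nat; intros; symmetry; apply scaled_moment_kappa0.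
- induction m as [[|p] IHm] using (well_founded_induction lt_wf).
  + apply (expands_ext (fun _ => 0)); [|apply expands_const].
    exists (S d); intros b hb; symmetry; apply scaled_moment_0, hb.
  + eapply expands_ext;
      [exists (S d); intros b hb; symmetry; apply scaled_moment_solve, hb|].
    apply expands_mul; [apply expands_denominator|].
    apply expands_plus; [apply expands_mul; [apply expands_pow, expands_inv | apply IHk]|].
    apply (expands_rsum (S p) (fun j b => Binomial.C (S p) j *
        ((/ INR b) ^ j * ((/ INR b) ^ S (S p - j) * power_sum (S p - j) b)
           * scaled_moment d (S kappa) j b
         - INR d ^ (S p - j) * (/ INR b) ^ S (S p) * scaled_moment d (S kappa) j b
         + INR d ^ (S p - j) * (/ INR b) ^ p * scaled_moment d kappa j b))).
    intros j hj; apply expands_mul; [apply expands_const|].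
    expands_tac; first [apply IHk | apply IHm; lia].
Qed.

(** From the second moment on, and for [kappa >= 1], one more power of [b] is gained. *)
Lemma expands_scaled_moment_higher d kappa q :
  expands (fun b => INR b * scaled_moment d (S kappa) (S (S q)) b).
Proof.
set (p := S q).
apply (expands_ext (fun b => / (1 + ((/ INR b) ^ S p - (/ INR b) ^ p) / INR b) *
    ((/ INR b) ^ q * scaled_moment d kappa (S p) b
     + (INR d ^ S p * (/ INR b) ^ q * scaled_moment d kappa 0 b
     + rsum p (fun i => Binomial.C (S p) (S i) *
        ((/ INR b) ^ i * ((/ INR b) ^ S (p - i) * power_sum (p - i) b)
           * scaled_moment d (S kappa) (S i) b
         - INR d ^ (p - i) * (/ INR b) ^ S p * scaled_moment d (S kappa) (S i) b
         + INR d ^ (p - i) * (/ INR b) ^ q * scaled_moment d kappa (S i) b)))))).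
- exists (S d); intros b hb; fold p; rewrite (scaled_moment_solve d kappa p b hb).
  pose proof (INR_gt0 b ltac:(lia)) as hp.
  rewrite rsum_first, (scaled_moment_0 d kappa b hb), Nat.sub_0_r.
  replace (Binomial.C (S p) 0) with 1.
  2: { unfold Binomial.C; rewrite Nat.sub_0_r; simpl (INR (fact 0)); field.
       apply not_0_INR, fact_neq_0. }
  rewrite (rsum_ext p (fun i => Binomial.C (S p) (S i) * _)
   (fun i => INR b * (Binomial.C (S p) (S i) *
        ((/ INR b) ^ S i * ((/ INR b) ^ S (p - i) * power_sum (p - i) b)
           * scaled_moment d (S kappa) (S i) b
         - INR d ^ (p - i) * (/ INR b) ^ S (S p) * scaled_moment d (S kappa) (S i) b
         + INR d ^ (p - i) * (/ INR b) ^ p * scaled_moment d kappa (S i) b)))).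
  + rewrite rsum_scal.
    rewrite (rsum_ext p (fun i => Binomial.C (S p) (S i) * _)
      (fun i => Binomial.C (S p) (S i) *
        ((/ INR b) ^ S i * ((/ INR b) ^ S (S p - S i) * power_sum (S p - S i) b)
           * scaled_moment d (S kappa) (S i) b
         - INR d ^ (S p - S i) * (/ INR b) ^ S (S p) * scaled_moment d (S kappa) (S i) b
         + INR d ^ (S p - S i) * (/ INR b) ^ p * scaled_moment d kappa (S i) b)))
      by reflexivity.
    replace ((/ INR b) ^ q) with (INR b * (/ INR b) ^ p)
      by (unfold p; cbn [pow]; field; lra).
    ring.
  + intros i _.
    replace ((/ INR b) ^ i) with (INR b * (/ INR b) ^ S i) by (cbn [pow]; field; lra).
    replace ((/ INR b) ^ S p) with (INR b * (/ INR b) ^ S (S p)) by (cbn [pow]; field; lra).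
    replace ((/ INR b) ^ q) with (INR b * (/ INR b) ^ p)
      by (unfold p; cbn [pow]; field; lra).
    ring.
- apply expands_mul; [apply expands_denominator|].
  apply expands_plus; [|apply expands_plus].
  + apply expands_mul; [apply expands_pow, expands_inv | apply expands_scaled_moment].
  + expands_tac; apply expands_scaled_moment.
  + apply (expands_rsum p (fun i b => Binomial.C (S p) (S i) *
        ((/ INR b) ^ i * ((/ INR b) ^ S (p - i) * power_sum (p - i) b)
           * scaled_moment d (S kappa) (S i) b
         - INR d ^ (p - i) * (/ INR b) ^ S p * scaled_moment d (S kappa) (S i) b
         + INR d ^ (p - i) * (/ INR b) ^ q * scaled_moment d kappa (S i) b))).
    intros i _; expands_tac; apply expands_scaled_moment.
Qed.

(** * First coefficients of the first three moments *)

Lemma jet_eq l l' f g : jet l f -> l = l' -> eventually (fun b => f b = g b) -> jet l' g.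
Proof. intros hf <- e; exact (jet_ext _ _ _ e hf). Qed.

Lemma jet_poly l : jet l (fun b => horner l (/ INR b)).
Proof.
apply (jet_horner l _ (fun _ => 0)); [apply bounded_ev_const|].
exists 0%nat; intros; ring.
Qed.

Lemma jet_inv_mul f : expands f -> jet [0] (fun b => / INR b * f b).
Proof. intros hf; apply (jet_shift []), expands_bounded, hf. Qed.

(** Proves the equality of two explicit lists entry by entry. *)
Ltac solve_list t :=
  cbn [addl mull scall map]; repeat (apply (f_equal2 cons); [t | ]); try reflexivity.

Lemma jet_denominator1 :
  jet [1; 1; 0; -1] (fun b => / (1 - / INR b + (/ INR b) ^ 2)).
Proof.
assert (hb : bounded_ev (fun b => / (1 + (/ INR b - 1) / INR b))).
{ apply bounded_ev_inv_denominator, expands_bounded.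
  apply expands_minus; [apply expands_inv | apply expands_const]. }
apply (jet_horner _ _ (fun b => (/ INR b - 1) * / (1 + (/ INR b - 1) / INR b))).
- apply bounded_ev_mul; [|exact hb].
  apply expands_bounded, expands_minus; [apply expands_inv | apply expands_const].
- exists 1%nat; intros b hb'; pose proof (INR_gt0 b hb') as hp.
  cbn [horner length]; unfold Rdiv; set (x := / INR b) in *.
  assert (hx : 1 - x + x ^ 2 <> 0) by nra.
  field; nra.
Qed.

Lemma jet_denominator1_pow n :
  jet [1; INR n; INR n * (INR n - 1) / 2; INR n * (INR n + 1) * (INR n - 4) / 6]
      (fun b => (/ (1 - / INR b + (/ INR b) ^ 2)) ^ n).
Proof.
induction n as [|n IH].
- eapply jet_eq; [apply (jet_const 1 3) | simpl repeat; simpl INR; solve_list ltac:(field) |].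
  exists 0%nat; reflexivity.
- eapply jet_eq; [apply (jet_mul _ _ _ _ jet_denominator1 IH) | |].
  + rewrite S_INR; solve_list ltac:(field).
  + exists 0%nat; reflexivity.
Qed.

Lemma scaled_moment_1 d kappa b : (d < b)%nat ->
  scaled_moment d (S kappa) 1 b
  = - (INR d + 1 / 2) * (/ (1 - / INR b + (/ INR b) ^ 2)) ^ S kappa.
Proof.
intros hd; pose proof (INR_gt0 b ltac:(lia)) as hp.
assert (hx : 1 - / INR b + (/ INR b) ^ 2 <> 0) by (set (x := / INR b); nra).
enough (H : forall q, scaled_moment d (S q) 1 b = / (1 - / INR b + (/ INR b) ^ 2) *
  (scaled_moment d q 1 b + INR d * scaled_moment d q 0 b)).
{ induction kappa as [|kappa IH]; rewrite H.
  - rewrite !scaled_moment_kappa0; simpl; field.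
    simpl in hx; rewrite Rmult_1_r in hx.
    split; [lra|]; intros e; apply hx.
    apply Rmult_eq_reg_r with (INR b * INR b); [|nra].
    field_simplify; [lra | lra].
  - rewrite IH, scaled_moment_0 by exact hd; cbn [pow]; ring. }
intros q; pose proof (scaled_moment_rec d q 1 b hd (le_n 1)) as e.
cbn [rsum Nat.sub] in e; rewrite power_sum_0, power_sum_1, scaled_moment_0 in e by exact hd.
replace (Binomial.C 1 0) with 1 in e by (unfold Binomial.C; simpl; field).
replace (Binomial.C 1 1) with 1 in e by (unfold Binomial.C; simpl; field).
set (W := scaled_moment d (S q) 1 b) in *.
apply Rmult_eq_reg_l with (1 - / INR b + (/ INR b) ^ 2); [|exact hx].
rewrite <- Rmult_assoc, Rinv_r, Rmult_1_l by exact hx.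
apply Rmult_eq_reg_l with (INR b ^ 2); [|apply pow_nonzero; lra].
transitivity (INR b ^ 2 * W - INR b * W + W); [field; lra|].
rewrite e; ring.
Qed.

Lemma scaled_moment_1_jet d kappa : (1 <= kappa)%nat ->
  jet (scall (- (INR d + 1 / 2))
    [1; INR kappa; INR kappa * (INR kappa - 1) / 2;
     INR kappa * (INR kappa + 1) * (INR kappa - 4) / 6]) (scaled_moment d kappa 1).
Proof.
intros hk; destruct kappa as [|kappa]; [lia|].
eapply jet_ext; [|apply jet_scal, jet_denominator1_pow].
exists (S d); intros b hb; symmetry; apply scaled_moment_1, hb.
Qed.

(** [1 / (1 + h / b)] with [h = g / b] has no term in [1 / b]. *)
Lemma jet_denominator_flat g : expands g ->
  jet [1; 0] (fun b => / (1 + (/ INR b * g b) / INR b)).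
Proof.
intros hg.
assert (h0 : expands (fun b => / INR b * g b)) by (apply expands_mul; [apply expands_inv | exact hg]).
assert (h1 : jet [1] (fun b => / (1 + (/ INR b * g b) / INR b))).
{ apply (jet_inv_denominator [] [] (fun b => / INR b * g b)).
  - apply expands_bounded, h0.
  - apply expands_bounded, (expands_inv_denominator _ h0). }
pose proof (jet_inv_denominator _ _ _ (jet_inv_mul _ hg) h1) as h2.
eapply jet_eq; [exact h2 | solve_list ltac:(ring) |].
exists 0%nat; reflexivity.
Qed.

Lemma scaled_moment_2 d kappa b : (d < b)%nat ->
  INR b * scaled_moment d (S kappa) 2 b
  = / (1 + (/ INR b * (/ INR b - 1)) / INR b) *
    (scaled_moment d kappa 2 b
     + horner [1; -1; - 2 * INR d] (/ INR b) * scaled_moment d (S kappa) 1 b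
     + 2 * INR d * scaled_moment d kappa 1 b + INR d ^ 2 * scaled_moment d kappa 0 b).
Proof.
intros hd; pose proof (INR_gt0 b ltac:(lia)) as hp.
assert (hb1 : 1 <= INR b) by (apply (le_INR 1); lia).
pose proof (scaled_moment_rec d kappa 2 b hd ltac:(lia)) as e.
cbn [rsum Nat.sub] in e; rewrite power_sum_0, power_sum_1, scaled_moment_0 in e by exact hd.
replace (Binomial.C 2 0) with 1 in e by (unfold Binomial.C; simpl; field).
replace (Binomial.C 2 1) with 2 in e by (unfold Binomial.C; simpl; field).
replace (Binomial.C 2 2) with 1 in e by (unfold Binomial.C; simpl; field).
set (W := scaled_moment d (S kappa) 2 b) in *.
assert (hnz : 1 + (/ INR b * (/ INR b - 1)) / INR b <> 0).
{ assert (h1 : 0 < / INR b <= 1).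
  { split; [apply Rinv_0_lt_compat, hp|].
    rewrite <- Rinv_1; apply Rinv_le_contravar; lra. }
  unfold Rdiv; set (x := / INR b) in *; nra. }
apply Rmult_eq_reg_l with (1 + (/ INR b * (/ INR b - 1)) / INR b); [|exact hnz].
rewrite <- (Rmult_assoc _ (/ _)), Rinv_r, Rmult_1_l by exact hnz.
apply Rmult_eq_reg_l with (INR b ^ 2); [|apply pow_nonzero; lra].
transitivity (INR b ^ 3 * W - (INR b - 1) * W); [field; lra|].
rewrite e; cbn [horner]; field; lra.
Qed.

(** Leading coefficient of [b] times the scaled second moment. For [kappa = 1] the recursion
    starts from minus the Lebesgue moments; this is what singles out [k = 3]. *)
Definition lead2 (d kappa : nat) : R :=
  if Nat.eqb kappa 1 then - (INR d ^ 2 + 2 * INR d + 5 / 6)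
  else - (INR d + 1 / 2) * (1 + 2 * INR d).

Lemma scaled_moment_2_jet1 d kappa : (1 <= kappa)%nat ->
  jet [lead2 d kappa] (fun b => INR b * scaled_moment d kappa 2 b).
Proof.
intros hk; destruct kappa as [|kappa]; [lia|].
assert (hu : jet [1; 0] (fun b => / (1 + (/ INR b * (/ INR b - 1)) / INR b))).
{ apply (jet_denominator_flat (fun b => / INR b - 1)).
  apply expands_minus; [apply expands_inv | apply expands_const]. }
pose proof (scaled_moment_1_jet d (S kappa) ltac:(lia)) as h1.
assert (H : forall c2 c1 c0, jet [c2] (scaled_moment d kappa 2) ->
   jet [c1] (scaled_moment d kappa 1) -> jet [c0] (scaled_moment d kappa 0) ->
   c2 + - (INR d + 1 / 2) + 2 * INR d * c1 + INR d ^ 2 * c0 = lead2 d (S kappa) ->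
   jet [lead2 d (S kappa)] (fun b => INR b * scaled_moment d (S kappa) 2 b)).
{ intros c2 c1 c0 j2 j1 j0 <-.
  eapply jet_eq; [apply (jet_mul _ _ _ _ hu (jet_plus _ _ _ _ (jet_plus _ _ _ _
     (jet_plus _ _ _ _ j2 (jet_mul _ _ _ _ (jet_poly [1; -1; - 2 * INR d]) h1))
     (jet_scal (2 * INR d) _ _ j1)) (jet_scal (INR d ^ 2) _ _ j0))) | |].
  - solve_list ltac:(ring).
  - exists (S d); intros b hb; symmetry; apply scaled_moment_2, hb. }
destruct kappa as [|kappa].
- apply (H (- / INR 3) (- / INR 2) (- / INR 1)).
  + eapply jet_ext; [|apply (jet_const _ 0)]; exists 0%nat; intros; symmetry; apply scaled_moment_kappa0.
  + eapply jet_ext; [|apply (jet_const _ 0)]; exists 0%nat; intros; symmetry; apply scaled_moment_kappa0.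
  + eapply jet_ext; [|apply (jet_const _ 0)]; exists 0%nat; intros; symmetry; apply scaled_moment_kappa0.
  + unfold lead2; simpl; field.
- apply (H 0 (- (INR d + 1 / 2)) 0).
  + eapply jet_eq; [apply (jet_inv_mul _ (expands_scaled_moment_higher d kappa 0)) | reflexivity |].
    exists 1%nat; intros b hb; pose proof (INR_gt0 b hb); field; lra.
  + eapply jet_eq; [apply (jet_prefix [_] _ _ (scaled_moment_1_jet d (S kappa) ltac:(lia)))
      | solve_list ltac:(ring) | exists 0%nat; reflexivity].
  + eapply jet_ext; [|apply (jet_const _ 0)]; exists (S d); intros b hb; symmetry;
      apply scaled_moment_0, hb.
  + unfold lead2; simpl; field.
Qed.

Lemma scaled_moment_2_jet2 d kappa : (1 <= kappa)%nat ->
  jet [lead2 d (S kappa);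
       lead2 d kappa - (INR d + 1 / 2) * INR kappa * (1 + 2 * INR d)]
      (fun b => INR b * scaled_moment d (S kappa) 2 b).
Proof.
intros hk.
assert (hu : jet [1; 0] (fun b => / (1 + (/ INR b * (/ INR b - 1)) / INR b))).
{ apply (jet_denominator_flat (fun b => / INR b - 1)).
  apply expands_minus; [apply expands_inv | apply expands_const]. }
pose proof (scaled_moment_1_jet d (S kappa) ltac:(lia)) as h1.
pose proof (scaled_moment_1_jet d kappa hk) as h1'.
assert (h2 : jet [0; lead2 d kappa] (scaled_moment d kappa 2)).
{ eapply jet_ext; [|apply (jet_shift _ _ (scaled_moment_2_jet1 d kappa hk))].
  exists 1%nat; intros b hb; pose proof (INR_gt0 b hb); field; lra. }
assert (h0 : jet [0; 0] (scaled_moment d kappa 0)).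
{ destruct kappa as [|q]; [lia|].
  eapply jet_ext; [|apply (jet_const _ 1)]; exists (S d); intros b hb; symmetry;
      apply scaled_moment_0, hb. }
eapply jet_eq; [apply (jet_mul _ _ _ _ hu (jet_plus _ _ _ _ (jet_plus _ _ _ _
     (jet_plus _ _ _ _ h2 (jet_mul _ _ _ _ (jet_poly [1; -1; - 2 * INR d]) h1))
     (jet_scal (2 * INR d) _ _ h1')) (jet_scal (INR d ^ 2) _ _ h0))) | |].
- assert (e : lead2 d (S kappa) = - (INR d + 1 / 2) * (1 + 2 * INR d)).
  { unfold lead2; destruct kappa; [lia | reflexivity]. }
  rewrite e, S_INR; solve_list ltac:(field).
- exists (S d); intros b hb; symmetry; apply scaled_moment_2, hb.
Qed.

Lemma scaled_moment_3_jet1 d kappa : (1 <= kappa)%nat ->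
  jet [- (INR d + 1 / 2)] (fun b => INR b * scaled_moment d (S kappa) 3 b).
Proof.
intros hk.
set (u := fun b => / (1 + (/ INR b * ((/ INR b) ^ 2 - / INR b)) / INR b)).
assert (hu : jet [1; 0] u).
{ apply (jet_denominator_flat (fun b => (/ INR b) ^ 2 - / INR b)).
  apply expands_minus; [apply expands_pow|]; apply expands_inv. }
pose proof (scaled_moment_1_jet d (S kappa) ltac:(lia)) as h1.
set (rest := fun b => 3 * INR d ^ 2 * scaled_moment d kappa 1 b
   + 3 * horner [1 / 2; - 1 / 2; - INR d] (/ INR b) * scaled_moment d (S kappa) 2 b
   + 3 * INR d * scaled_moment d kappa 2 b + scaled_moment d kappa 3 b).
assert (hr : expands rest).
{ assert (hh : expands (fun b => horner [1 / 2; - 1 / 2; - INR d] (/ INR b))).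
  { cbn [horner]; expands_tac. }
  unfold rest; expands_tac; first [exact hh | apply expands_scaled_moment]. }
eapply jet_eq; [apply (jet_mul _ _ _ _ hu (jet_plus _ _ _ _
   (jet_mul _ _ _ _ (jet_poly [1; - 3 / 2; 1 / 2; - 3 * INR d ^ 2]) h1) (jet_inv_mul _ hr))) | |].
- solve_list ltac:(ring).
- exists (S d); intros b hb; unfold u, rest; clear hu hr.
  pose proof (INR_gt0 b ltac:(lia)) as hp.
  assert (hb1 : 1 <= INR b) by (apply (le_INR 1); lia).
  pose proof (scaled_moment_rec d kappa 3 b hb ltac:(lia)) as e.
  cbn [rsum Nat.sub] in e.
  rewrite power_sum_0, power_sum_1, power_sum_2, scaled_moment_0 in e by exact hb.
  replace (scaled_moment d kappa 0 b) with 0 in e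
    by (destruct kappa as [|q]; [lia | symmetry; apply scaled_moment_0, hb]).
  replace (Binomial.C 3 0) with 1 in e by (unfold Binomial.C; simpl; field).
  replace (Binomial.C 3 1) with 3 in e by (unfold Binomial.C; simpl; field).
  replace (Binomial.C 3 2) with 3 in e by (unfold Binomial.C; simpl; field).
  replace (Binomial.C 3 3) with 1 in e by (unfold Binomial.C; simpl; field).
  set (W := scaled_moment d (S kappa) 3 b) in *.
  assert (hnz : 1 + (/ INR b * ((/ INR b) ^ 2 - / INR b)) / INR b <> 0).
  { assert (hx : 0 < / INR b <= 1).
    { split; [apply Rinv_0_lt_compat, hp|].
      rewrite <- Rinv_1; apply Rinv_le_contravar; lra. }
    unfold Rdiv; set (x := / INR b) in *.
    assert (0 < x * x <= 1) by nra; nra. }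
  symmetry.
  apply Rmult_eq_reg_l with (1 + (/ INR b * ((/ INR b) ^ 2 - / INR b)) / INR b); [|exact hnz].
  rewrite <- (Rmult_assoc _ (/ _)), Rinv_r, Rmult_1_l by exact hnz.
  apply Rmult_eq_reg_l with (INR b ^ 3); [|apply pow_nonzero; lra].
  transitivity (INR b ^ 4 * W - (INR b - 1) * W); [field; lra|].
  rewrite e; cbn [horner]; field; lra.
Qed.

(** * Expansions of the terms of the sum over moments *)

(** Up to a small error, [b^(2k-1) (irwin_sum b d k - b ln b)] is an alternating sum of these,
    see [irwin_sum_scaled_terms]. *)
Definition scaled_term (d k j b : nat) : R := INR b ^ (2 * k) * moment_term b d k j.

(** The weights of the three kinds of two-digit integers in [moment_term]: all of them,
    those with a digit [d] (counted with multiplicity), and [d b + d], the last one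
    up to the factor [b^-(j+2)]. *)
Definition weight_all (j b : nat) : R := zeta_sum (j + 2) (b * b) - zeta_sum (j + 2) b.
Definition weight_one (d j b : nat) : R :=
  zeta_sum (j + 2) (S d * b) - zeta_sum (j + 2) (d * b) + shifted_sum d (j + 2) 0 b.
Definition weight_two (d j b : nat) : R := (/ INR d * / (1 + 1 / INR b)) ^ (j + 2).

Lemma scaled_term_split d k j b : (1 <= d)%nat -> (1 <= b)%nat ->
  scaled_term d (S k) j b
  = (/ INR b) ^ 2 * scaled_moment d (S (S k)) (S j) b * weight_all j b
    + (scaled_moment d (S k) (S j) b - (/ INR b) ^ 2 * scaled_moment d (S (S k)) (S j) b)
      * weight_one d j b
    + (/ INR b) ^ j * weight_two d j b *
      (scaled_moment d k (S j) b - 2 * (/ INR b) ^ 2 * scaled_moment d (S k) (S j) b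
       + (/ INR b) ^ 4 * scaled_moment d (S (S k)) (S j) b).
Proof.
intros hd hb; pose proof (INR_gt0 b hb) as hp; pose proof (INR_gt0 d hd) as hp'.
unfold scaled_term, moment_term, scaled_moment, weight_all, weight_one; cbn [Nat.pred].
replace ((/ INR (d * b + d)) ^ (j + 2)) with ((/ INR b) ^ (j + 2) * weight_two d j b).
2: { unfold weight_two; rewrite <- Rpow_mult_distr; f_equal.
     rewrite plus_INR, mult_INR; field; repeat split; nra. }
replace (2 * S (S k))%nat with (2 * k + 4)%nat by lia.
replace (2 * S k)%nat with (2 * k + 2)%nat by lia.
rewrite !pow_add, !pow_inv; set (y := INR b ^ j).
assert (y <> 0) by (apply pow_nonzero; lra).
set (z := INR b ^ (2 * k)); field; split; lra.
Qed.

Lemma expands_weight_all j : expands (weight_all j).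
Proof.
pose proof (expands_zeta_sum (j + 2) ltac:(lia)) as h.
apply expands_minus; [exact (expands_compose_square _ h) | exact h].
Qed.

Lemma expands_shifted_sum0 d s : (2 <= s)%nat -> expands (fun b => shifted_sum d s 0 b).
Proof.
intros hs.
apply (expands_ext (fun b => (/ INR b) ^ s * (INR b ^ (s + 0) * shifted_sum d s 0 b))).
- exists 1%nat; intros b hb; pose proof (INR_gt0 b hb); rewrite Nat.add_0_r, pow_inv.
  field; apply pow_nonzero; lra.
- apply expands_mul; [apply expands_pow, expands_inv | apply expands_shifted_sum; lia].
Qed.

Lemma expands_weight_one d j : (1 <= d)%nat -> expands (weight_one d j).
Proof.
intros hd; pose proof (expands_zeta_sum (j + 2) ltac:(lia)) as h.
apply expands_plus; [apply expands_minus|].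
- apply (expands_compose_scal (S d) _ ltac:(lia) h).
- apply (expands_compose_scal d _ hd h).
- apply expands_shifted_sum0; lia.
Qed.

Lemma expands_weight_two d j : expands (weight_two d j).
Proof.
apply expands_pow, expands_mul; [apply expands_const|].
apply (expands_inv_denominator (fun _ => 1)), expands_const.
Qed.

Lemma expands_scaled_term d k j : (1 <= d)%nat -> expands (scaled_term d (S k) j).
Proof.
intros hd; eapply expands_ext;
  [exists 1%nat; intros b hb; symmetry; apply scaled_term_split; assumption|].
expands_tac; first [apply expands_scaled_moment | apply expands_weight_all
  | apply expands_weight_one, hd | apply expands_weight_two].
Qed.

Lemma irwin_sum_scaled_terms d k J : (1 <= d)%nat -> (2 <= k)%nat ->
  exists r, bounded_ev r /\ eventually (fun b =>
    INR b ^ (2 * k - 1) * (irwin_sum b d k - INR b * ln (INR b))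
    = rsum (2 * k + J) (fun j => (-1) ^ S j * scaled_term d k j b) + r b * (/ INR b) ^ J).
Proof.
intros hd hk.
set (f := fun b => INR b ^ (2 * k - 1) * (irwin_sum b d k - INR b * ln (INR b))
  - rsum (2 * k + J) (fun j => (-1) ^ S j * scaled_term d k j b)).
exists (fun b => INR b ^ J * f b); split.
- exists 2, (S d); intros b hb; pose proof (INR_gt0 b ltac:(lia)) as hp.
  pose proof (irwin_sum_approx b d k (2 * k + J) ltac:(lia) hk) as h.
  replace (f b) with (INR b ^ (2 * k - 1) * (irwin_sum b d k - INR b * ln (INR b)
        - INR b * rsum (2 * k + J) (fun j => (-1) ^ S j * moment_term b d k j))).
  + rewrite !Rabs_mult, !(Rabs_right (INR b ^ _)) by (apply Rle_ge, pow_le; lra).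
    eapply Rle_trans.
    * apply Rmult_le_compat_l; [apply pow_le; lra|].
      apply Rmult_le_compat_l; [apply pow_le; lra | exact h].
    * right; rewrite pow_inv.
      replace (INR b ^ (2 * k + J + 2)) with (INR b ^ J * (INR b ^ (2 * k - 1) * INR b ^ 3))
        by (rewrite <- !pow_add; f_equal; lia).
      field; repeat split; try apply pow_nonzero; lra.
  + unfold f; rewrite Rmult_minus_distr_l; f_equal.
    rewrite <- Rmult_assoc, <- rsum_scal; apply rsum_ext; intros j _; unfold scaled_term.
    replace (2 * k)%nat with (2 * k - 1 + 1)%nat at 2 by lia; rewrite pow_add; ring.
- exists 1%nat; intros b hb; pose proof (INR_gt0 b hb) as hp; unfold f.
  rewrite pow_inv; field; apply pow_nonzero; lra.
Qed.

Lemma expands_irwin_sum d k : (1 <= d)%nat -> (2 <= k)%nat ->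
  expands (fun b => INR b ^ (2 * k - 1) * (irwin_sum b d k - INR b * ln (INR b))).
Proof.
intros hd hk; apply expands_approx; intros N.
destruct (irwin_sum_scaled_terms d k N hd hk) as [r [hr he]].
exists (fun b => rsum (2 * k + N) (fun j => (-1) ^ S j * scaled_term d k j b)), r.
split; [|split; assumption].
apply (expands_rsum _ (fun j b => (-1) ^ S j * scaled_term d k j b)); intros j _.
apply expands_mul; [apply expands_const|].
destruct k as [|k]; [lia | apply expands_scaled_term, hd].
Qed.

(** * The first four coefficients *)

Lemma jet_compose_square c f : jet [c] f -> jet [c; 0] (fun b => f (b * b)%nat).
Proof.
intros hf.
change (jet [0] (fun b => INR b * (f (b * b)%nat - c))).
assert (h : jet [] (fun b => INR (b * b) * (f (b * b)%nat - c))).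
{ destruct hf as [C [M H]]; exists C, M; intros n hn; apply H; nia. }
eapply jet_ext; [|apply (jet_shift _ _ h)].
exists 1%nat; intros b hb; rewrite mult_INR; pose proof (INR_gt0 b hb); field; lra.
Qed.

Lemma weight_all_jet1 j : jet [0] (weight_all j).
Proof.
pose proof (zeta_sum_jet1 (j + 2) ltac:(lia)) as h.
eapply jet_eq; [apply (jet_plus _ _ _ _ (jet_compose_square _ _ h) (jet_scal (-1) _ _ h)) | |].
- solve_list ltac:(ring).
- exists 0%nat; intros; unfold weight_all; ring.
Qed.

Lemma weight_all_0_jet : jet [0; 1] (weight_all 0).
Proof.
pose proof (jet_prefix [_; _] [_; _] _ zeta_sum_2_jet) as h.
pose proof (jet_prefix [_] [_] _ h) as h'.
eapply jet_eq; [apply (jet_plus _ _ _ _ (jet_compose_square _ _ h') (jet_scal (-1) _ _ h)) | |].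
- solve_list ltac:(ring).
- exists 0%nat; intros; unfold weight_all; simpl Nat.add; ring.
Qed.

Lemma weight_one_0_jet d : (1 <= d)%nat ->
  jet [0; / INR d - / (INR d + 1);
       (/ INR d ^ 2 - / (INR d + 1) ^ 2) / 2 + zeta 2;
       (/ INR d ^ 3 - / (INR d + 1) ^ 3) / 6 - 1 - 2 * INR d * zeta 3] (weight_one d 0).
Proof.
intros hd; pose proof (INR_gt0 d hd).
eapply jet_eq; [apply (jet_plus _ _ _ _ (jet_plus _ _ _ _
   (jet_compose_scal (S d) _ ltac:(lia) _ zeta_sum_2_jet)
   (jet_scal (-1) _ _ (jet_compose_scal d _ hd _ zeta_sum_2_jet)))
   (jet_shift _ _ (jet_shift _ _ (shifted_sum_2_jet d)))) | |].
- cbn [dilate]; rewrite S_INR; solve_list ltac:(field; lra).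
- exists 1%nat; intros b hb; pose proof (INR_gt0 b hb).
  unfold weight_one; simpl Nat.add; field; lra.
Qed.

Lemma zeta_sum_jet3 s : (3 <= s)%nat -> exists L,
  jet [L; 0; if Nat.eqb s 3 then -1/2 else 0] (zeta_sum s).
Proof.
intros hs; destruct (Nat.eqb_spec s 3) as [-> | hne].
- destruct (limit_rate (fun n => zeta_sum 3 n + 1 / 2 * (/ INR n) ^ 2) 2) as [L hL].
  + (* The increment is exactly [(3 n + 2) / (2 n^3 (n + 1)^2)]. *)
    apply (bounded_ev_ext (fun n =>
       (INR n / INR (S n)) ^ 2 * (3 / 2 + / INR n))).
    * exists 1%nat; intros n hn; rewrite zeta_sum_succ by exact hn.
      rewrite S_INR; pose proof (INR_gt0 n hn); field; lra.
    * apply bounded_ev_mul; [apply expands_bounded, expands_pow, expands_succ_ratio|].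
      apply bounded_ev_plus; [apply bounded_ev_const | apply bounded_ev_inv].
  + exists L; apply (jet_horner _ _ _ hL).
    exists 1%nat; intros n hn; pose proof (INR_gt0 n hn); cbn [horner length]; field; lra.
- destruct (limit_rate (zeta_sum s) 2) as [L hL].
  + apply (bounded_ev_ext (fun n => (/ INR n) ^ (s - 4))).
    * exists 1%nat; intros n hn; rewrite zeta_sum_succ by exact hn.
      pose proof (INR_gt0 n hn).
      replace ((/ INR n) ^ s) with ((/ INR n) ^ (s - 4) * (/ INR n) ^ 4)
        by (rewrite <- pow_add; f_equal; lia).
      set (z := (/ INR n) ^ (s - 4)); field; lra.
    * apply expands_bounded, expands_pow, expands_inv.
  + exists L; apply (jet_horner _ _ _ hL).
    exists 1%nat; intros n hn; pose proof (INR_gt0 n hn); cbn [horner length]; field; lra.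
Qed.

Lemma weight_one_jet3 d j : (1 <= d)%nat -> (1 <= j)%nat ->
  jet [0; 0; if Nat.eqb j 1 then (/ INR d ^ 2 - / (INR d + 1) ^ 2) / 2 else 0] (weight_one d j).
Proof.
intros hd hj; pose proof (INR_gt0 d hd).
destruct (zeta_sum_jet3 (j + 2) ltac:(lia)) as [L hL].
assert (hs : jet [] (fun b => (/ INR b) ^ (j - 1) *
    (INR b ^ (j + 2 + 0) * shifted_sum d (j + 2) 0 b))).
{ apply expands_bounded, expands_mul; [apply expands_pow, expands_inv|].
  apply expands_shifted_sum; lia. }
eapply jet_eq; [apply (jet_plus _ _ _ _ (jet_plus _ _ _ _
   (jet_compose_scal (S d) _ ltac:(lia) _ hL)
   (jet_scal (-1) _ _ (jet_compose_scal d _ hd _ hL)))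
   (jet_shift _ _ (jet_shift _ _ (jet_shift _ _ hs)))) | |].
- cbn [dilate]; rewrite S_INR.
  replace (Nat.eqb (j + 2) 3) with (Nat.eqb j 1)
    by (destruct (Nat.eqb_spec j 1), (Nat.eqb_spec (j + 2) 3); reflexivity || lia).
  destruct (Nat.eqb j 1); solve_list ltac:(field; lra).
- exists 1%nat; intros b hb; pose proof (INR_gt0 b hb).
  unfold weight_one; rewrite Nat.add_0_r.
  replace (INR b ^ (j + 2)) with (INR b ^ (j - 1) * INR b ^ 3)
    by (rewrite <- pow_add; f_equal; lia).
  rewrite pow_inv; field; split; [apply pow_nonzero|]; lra.
Qed.

Lemma weight_two_jet d j : (1 <= d)%nat ->
  jet (mull [1; - INR (j + 2); INR (j + 2) * (INR (j + 2) + 1) / 2;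
       - (INR (j + 2) * (INR (j + 2) + 1) * (INR (j + 2) + 2) / 6)]
       [(/ INR d) ^ (j + 2); 0; 0; 0]) (weight_two d j).
Proof.
intros hd; unfold weight_two.
set (u := fun b : nat => / (1 + 1 / INR b)).
assert (h1 : jet [1; -1; 1; -1] u).
{ assert (h : jet [] u) by (apply bounded_ev_inv_denominator, bounded_ev_const).
  apply (jet_horner _ _ u h); exists 1%nat; intros b hb; pose proof (INR_gt0 b hb).
  unfold u; cbn [horner length]; field; lra. }
assert (h2 : forall n, jet [1; - INR n; INR n * (INR n + 1) / 2;
       - (INR n * (INR n + 1) * (INR n + 2) / 6)] (fun b => u b ^ n)).
{ induction n as [|n IH].
  - eapply jet_eq; [apply (jet_const 1 3) | simpl repeat; simpl INR; solve_list ltac:(field)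
      | exists 0%nat; reflexivity].
  - eapply jet_eq; [apply (jet_mul _ _ _ _ h1 IH)
      | rewrite S_INR; solve_list ltac:(field) | exists 0%nat; reflexivity]. }
eapply jet_ext; [|apply (jet_mul _ _ _ _ (h2 (j + 2)%nat) (jet_const ((/ INR d) ^ (j + 2)) 3))].
exists 0%nat; intros b _; rewrite Rpow_mult_distr; unfold u; ring.
Qed.

(** Contribution of the moments of order one. *)
Lemma scaled_term_0_jet d k : (1 <= d)%nat -> (1 <= k)%nat ->
  let D := INR d + 1 / 2 in let K := INR k in
  let q1 := / INR d - / (INR d + 1) in
  let q2 := (/ INR d ^ 2 - / (INR d + 1) ^ 2) / 2 + zeta 2 in
  let q3 := (/ INR d ^ 3 - / (INR d + 1) ^ 3) / 6 - 1 - 2 * INR d * zeta 3 in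
  jet [- D / INR d ^ 2;
       - D * (q1 + (K - 2) / INR d ^ 2);
       - D * (q2 + (K + 1) * q1
         + (3 - 2 * K + K * (K - 1) / 2 - 2) / INR d ^ 2);
       - D * (1 + q3 + (K + 1) * q2 + ((K + 1) * K / 2 - 1) * q1
         + (-4 + 3 * K - K * (K - 1) + K * (K + 1) * (K - 4) / 6 + 2 * (1 - K)) / INR d ^ 2)]
   (scaled_term d (S k) 0).
Proof.
intros hd hk D K q1 q2 q3; pose proof (INR_gt0 d hd) as hp.
pose proof (scaled_moment_1_jet d k hk) as h0.
pose proof (scaled_moment_1_jet d (S k) ltac:(lia)) as h1.
pose proof (scaled_moment_1_jet d (S (S k)) ltac:(lia)) as h2.
pose proof (weight_two_jet d 0 hd) as hR.
pose proof (weight_one_0_jet d hd) as hQ; fold q1 q2 q3 in hQ.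
pose proof (jet_shift _ _ (jet_shift _ _ (jet_mul _ _ _ _ h2 weight_all_0_jet))) as t1.
pose proof (jet_mul _ _ _ _ h1 hQ) as t2.
pose proof (jet_scal (-1) _ _ (jet_shift _ _ (jet_shift _ _ (jet_mul _ _ _ _ h2 hQ)))) as t3.
pose proof (jet_mul _ _ _ _ hR h0) as t4.
pose proof (jet_scal (-2) _ _ (jet_shift _ _ (jet_shift _ _ (jet_mul _ _ _ _ hR h1)))) as t5.
pose proof (jet_shift _ _ (jet_shift _ _ (jet_shift _ _ (jet_shift _ _ (jet_mul _ _ _ _ hR h2))))) as t6.
eapply jet_eq; [exact (jet_plus _ _ _ _ t1 (jet_plus _ _ _ _ t2 (jet_plus _ _ _ _ t3
   (jet_plus _ _ _ _ t4 (jet_plus _ _ _ _ t5 t6))))) | |].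
- rewrite !S_INR; fold K; change (0 + 2)%nat with 2%nat; replace (INR 2) with 2 by reflexivity.
  unfold D; clearbody q1 q2 q3 K; solve_list ltac:(field; lra).
- exists 1%nat; intros b hb; pose proof (INR_gt0 b hb).
  rewrite scaled_term_split by assumption; rewrite pow_O; ring.
Qed.

Lemma inv_mul_scaled d kappa m b : (1 <= b)%nat ->
  scaled_moment d kappa m b = / INR b * (INR b * scaled_moment d kappa m b).
Proof. intros hb; pose proof (INR_gt0 b hb); field; lra. Qed.

(** Contribution of a moment of order [j + 1 >= 2], whose leading coefficient is [c], given
    the contribution [l] of the integer [d b + d]: up to [O(b^-4)] the rest only has a term in
    [b^-3], and only for [j = 1]. *)
Lemma scaled_term_jet d k j c l : (1 <= d)%nat -> (1 <= j)%nat ->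
  jet [c] (fun b => INR b * scaled_moment d (S k) (S j) b) ->
  jet l (fun b => (/ INR b) ^ S j * (weight_two d j b *
     (INR b * scaled_moment d k (S j) b
      + / INR b * (/ INR b * (- 2 * (INR b * scaled_moment d (S k) (S j) b)
      + / INR b * (/ INR b * (INR b * scaled_moment d (S (S k)) (S j) b))))))) ->
  jet (addl [0; 0; 0; if Nat.eqb j 1 then c * ((/ INR d ^ 2 - / (INR d + 1) ^ 2) / 2) else 0] l)
      (scaled_term d (S k) j).
Proof.
intros hd hj hc hl; destruct j as [|i]; [lia|]; set (j := S i) in *.
pose proof (weight_one_jet3 d j hd hj) as hQ.
assert (h2 : expands (fun b => INR b * scaled_moment d (S (S k)) (S j) b))
  by apply expands_scaled_moment_higher.
assert (h2' : exists e, jet [e] (fun b => INR b * scaled_moment d (S (S k)) (S j) b)).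
{ destruct (h2 1%nat) as [[|e [|e' l']] [hl' hj']]; try discriminate; exists e; exact hj'. }
destruct h2' as [e he].
pose proof (jet_shift _ _ (jet_shift _ _ (jet_shift _ _
  (jet_mul _ _ _ _ he (weight_all_jet1 j))))) as t1.
assert (hc3 : exists c1 c2, jet [c; c1; c2] (fun b => INR b * scaled_moment d (S k) (S j) b)).
{ destruct (expands_scaled_moment_higher d k i 3%nat) as [[|e0 [|e1 [|e2 [|]]]] [hl' hj']];
    try discriminate.
  change (S (S i)) with (S j) in hj'.
  pose proof (is_lim_seq_unique _ _ (jet_lim _ _ _ hj')) as u.
  rewrite (is_lim_seq_unique _ _ (jet_lim _ _ _ hc)) in u; injection u as ->.
  exists e1, e2; exact hj'. }
destruct hc3 as [c1 [c2 hc3]].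
pose proof (jet_shift _ _ (jet_mul _ _ _ _ hc3 hQ)) as t2.
pose proof (jet_scal (-1) _ _ (jet_shift _ _ (jet_shift _ _ (jet_shift _ _
  (jet_mul _ _ _ _ he (jet_prefix [_] _ _ hQ)))))) as t3.
eapply jet_eq; [exact (jet_plus _ _ _ _ (jet_plus _ _ _ _ t1 (jet_plus _ _ _ _ t2 t3)) hl) | |].
- f_equal; destruct (Nat.eqb j 1); solve_list ltac:(ring).
- exists 1%nat; intros b hb; pose proof (INR_gt0 b hb).
  pose proof (scaled_term_split d k j b hd hb) as e0.
  rewrite (inv_mul_scaled d k), (inv_mul_scaled d (S k)), (inv_mul_scaled d (S (S k))) in e0
    by exact hb.
  rewrite e0; cbn [pow]; ring.
Qed.

Lemma expands_jet1 f : expands f -> exists c, jet [c] f.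
Proof.
intros hf; destruct (hf 1%nat) as [[|c [|c' l]] [hl hj]]; try discriminate; exists c; exact hj.
Qed.

Lemma scaled_term_1_jet d k : (1 <= d)%nat -> (1 <= k)%nat ->
  let D := INR d + 1 / 2 in
  jet [0; 0; - D * (1 + 2 * INR d) / INR d ^ 3;
       - D * (1 + 2 * INR d) * ((/ INR d ^ 2 - / (INR d + 1) ^ 2) / 2)
       + (3 * D * (1 + 2 * INR d) + lead2 d k - D * INR k * (1 + 2 * INR d)) / INR d ^ 3]
   (scaled_term d (S (S k)) 1).
Proof.
intros hd hk D; pose proof (INR_gt0 d hd) as hp.
assert (e1 : forall q, lead2 d (S (S q)) = - D * (1 + 2 * INR d)) by reflexivity.
assert (e2 : lead2 d (S k) = - D * (1 + 2 * INR d)) by (destruct k as [|q]; [lia | apply e1]).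
pose proof (scaled_moment_2_jet2 d k hk) as h0.
pose proof (scaled_moment_2_jet1 d (S (S k)) ltac:(lia)) as h1.
assert (hx : jet [] (fun b => - 2 * (INR b * scaled_moment d (S (S k)) 2 b)
   + / INR b * (/ INR b * (INR b * scaled_moment d (S (S (S k))) 2 b)))).
{ apply expands_bounded, expands_plus; apply expands_mul;
    try apply expands_const; try apply expands_inv.
  - apply (expands_scaled_moment_higher d _ 0).
  - apply expands_mul; [apply expands_inv | apply (expands_scaled_moment_higher d _ 0)]. }
pose proof (jet_prefix [_; _] [_; _] _ (weight_two_jet d 1 hd)) as hR.
pose proof (jet_shift _ _ (jet_shift _ _ (jet_mul _ _ _ _ hR
  (jet_plus _ _ _ _ h0 (jet_shift _ _ (jet_shift _ _ hx)))))) as t.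
eapply jet_eq; [eapply (scaled_term_jet d (S k) 1 _ _ hd (le_n 1) h1);
  eapply jet_ext; [|exact t]; exists 0%nat; intros b _; ring | | exists 0%nat; reflexivity].
- rewrite e1, e2; fold D; change (INR (1 + 2)) with (INR 3); replace (INR 3) with 3 by (simpl; ring).
  simpl Nat.eqb; cbv iota; cbn [Nat.add]; solve_list ltac:(field; lra).
Qed.

Lemma scaled_term_2_jet d k : (1 <= d)%nat -> (1 <= k)%nat ->
  jet [0; 0; 0; - (INR d + 1 / 2) / INR d ^ 4] (scaled_term d (S (S k)) 2).
Proof.
intros hd hk; pose proof (INR_gt0 d hd) as hp.
pose proof (scaled_moment_3_jet1 d k hk) as h0.
pose proof (scaled_moment_3_jet1 d (S k) ltac:(lia)) as h1.
assert (hx : jet [] (fun b => / INR b * (- 2 * (INR b * scaled_moment d (S (S k)) 3 b)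
   + / INR b * (/ INR b * (INR b * scaled_moment d (S (S (S k))) 3 b))))).
{ apply expands_bounded, expands_mul; [apply expands_inv|].
  apply expands_plus; apply expands_mul; try apply expands_const; try apply expands_inv.
  - apply (expands_scaled_moment_higher d _ 1).
  - apply expands_mul; [apply expands_inv | apply (expands_scaled_moment_higher d _ 1)]. }
pose proof (jet_prefix [_] [_; _; _] _ (weight_two_jet d 2 hd)) as hR.
pose proof (jet_shift _ _ (jet_shift _ _ (jet_shift _ _ (jet_mul _ _ _ _ hR
  (jet_plus _ _ _ _ h0 (jet_shift _ _ hx)))))) as t.
eapply jet_eq; [eapply (scaled_term_jet d (S k) 2 _ _ hd (le_S _ _ (le_n 1)) h1);
  eapply jet_ext; [|exact t]; exists 0%nat; intros b _; ring | | exists 0%nat; reflexivity].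
- simpl Nat.eqb; cbv iota; cbn [Nat.add]; solve_list ltac:(field; lra).
Qed.

Lemma scaled_term_higher_jet d k i : (1 <= d)%nat ->
  jet [0; 0; 0; 0] (scaled_term d (S (S k)) (S (S (S i)))).
Proof.
intros hd; set (j := S (S (S i))).
destruct (expands_jet1 _ (expands_scaled_moment_higher d (S k) (S (S i)))) as [c hc].
assert (hx : jet [] (fun b => (/ INR b) ^ i * (weight_two d j b *
     (INR b * scaled_moment d (S k) (S j) b
      + / INR b * (/ INR b * (- 2 * (INR b * scaled_moment d (S (S k)) (S j) b)
      + / INR b * (/ INR b * (INR b * scaled_moment d (S (S (S k))) (S j) b)))))))).
{ assert (h : forall q, expands (fun b => INR b * scaled_moment d (S q) (S j) b))
    by (intros q; apply expands_scaled_moment_higher).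
  apply expands_bounded, expands_mul; [apply expands_pow, expands_inv|].
  apply expands_mul; [apply expands_weight_two|].
  apply expands_plus; [apply h|].
  apply expands_mul; [apply expands_inv|]; apply expands_mul; [apply expands_inv|].
  apply expands_plus; apply expands_mul; try apply expands_const; try apply expands_inv;
    [apply h|].
  apply expands_mul; [apply expands_inv | apply h]. }
pose proof (jet_shift _ _ (jet_shift _ _ (jet_shift _ _ (jet_shift _ _ hx)))) as t.
eapply jet_eq; [eapply (scaled_term_jet d (S k) j c _ hd ltac:(lia) hc);
  eapply jet_ext; [|exact t]; exists 0%nat; intros b _;
  change ((/ INR b) ^ S j) with (/ INR b * (/ INR b * (/ INR b * (/ INR b * (/ INR b) ^ i)))); ring
  | | exists 0%nat; reflexivity].
- simpl Nat.eqb; cbv iota; solve_list ltac:(ring).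
Qed.

Lemma jet_rsum_zero n (f : nat -> nat -> R) : (forall i, jet [0; 0; 0; 0] (f i)) ->
  jet [0; 0; 0; 0] (fun b => rsum n (fun i => f i b)).
Proof.
intros H; induction n as [|n IH]; [apply (jet_zero 4)|]; cbn [rsum].
eapply jet_eq; [apply (jet_plus _ _ _ _ IH (H n)) | solve_list ltac:(ring) | exists 0%nat; reflexivity].
Qed.

(** The claimed coefficients, as an expansion of the quantity multiplied by [b^(2k-1)]. *)
Lemma irwin_sum_jet d k : (1 <= d)%nat -> (3 <= k)%nat ->
  jet [coef1 (INR d); coef2 (INR d) (INR k); coef3 (INR d) (INR k); coef4 d k]
    (fun b => INR b ^ (2 * k - 1) * (irwin_sum b d k - INR b * ln (INR b))).
Proof.
intros hd hk.
destruct (irwin_sum_scaled_terms d k 4 hd ltac:(lia)) as [r [hr he]].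
destruct k as [|[|k]]; try lia.
pose proof (scaled_term_0_jet d (S k) hd ltac:(lia)) as t0.
pose proof (scaled_term_1_jet d k hd ltac:(lia)) as t1.
pose proof (scaled_term_2_jet d k hd ltac:(lia)) as t2.
assert (t3 : jet [0; 0; 0; 0] (fun b => rsum (2 * S (S k) + 1)
   (fun i => (-1) ^ S (S (S (S i))) * scaled_term d (S (S k)) (S (S (S i))) b))).
{ apply (jet_rsum_zero (2 * S (S k) + 1)
   (fun i b => (-1) ^ S (S (S (S i))) * scaled_term d (S (S k)) (S (S (S i))) b)).
  intros i; eapply jet_eq; [apply (jet_scal ((-1) ^ S (S (S (S i)))) _ _ (scaled_term_higher_jet d k i hd))
    | solve_list ltac:(ring) | exists 0%nat; reflexivity]. }
pose proof (jet_shift _ _ (jet_shift _ _ (jet_shift _ _ (jet_shift [] r hr)))) as t4.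
cbv zeta in t0, t1.
eapply jet_eq; [apply (jet_plus _ _ _ _ (jet_scal (-1) _ _ t0) (jet_plus _ _ _ _ t1
   (jet_plus _ _ _ _ (jet_scal (-1) _ _ t2) (jet_plus _ _ _ _ t3 t4)))) | |].
- pose proof (INR_gt0 d hd) as hp; unfold coef4, coef1, coef2, coef3, coef4_generic, coef4_poly.
  rewrite !S_INR.
  assert (e : (lead2 d k = - (INR d ^ 2 + 2 * INR d + 5 / 6) /\ INR k = 1
                /\ Nat.eqb (S (S k)) 3 = true)
     \/ (lead2 d k = - (INR d + 1 / 2) * (1 + 2 * INR d) /\ Nat.eqb (S (S k)) 3 = false)).
  { unfold lead2; destruct k as [|[|k]]; [lia | left | right]; repeat split. }
  destruct e as [[-> [-> ->]] | [-> ->]]; solve_list ltac:(field; lra).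
- destruct he as [M he]; exists (M + 1)%nat; intros b hb; rewrite he by lia.
  replace (2 * S (S k) + 4)%nat with (S (S (S (2 * S (S k) + 1)))) by lia.
  rewrite 3 rsum_first; cbn [pow]; ring.
Qed.

Theorem proposition14 (d k : nat) (hd : (0 < d)%nat) (hk : (3 <= k)%nat) :
  (exists a : nat -> R,
     is_asymptotic_expansion
       (fun b : nat => irwin_sum b d k - INR b * ln (INR b)) a)
  /\
  is_bigO
    (fun b : nat =>
       irwin_sum b d k
       - (INR b * ln (INR b)
          + coef1 (INR d) / INR b ^ (2 * k - 1)
          + coef2 (INR d) (INR k) / INR b ^ (2 * k)
          + coef3 (INR d) (INR k) / INR b ^ (2 * k + 1)
          + coef4 d k / INR b ^ (2 * k + 2)))
    (fun b : nat => / INR b ^ (2 * k + 3))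
  /\
  (k = 3%nat ->
     coef4 d k =
       - (2 * INR d + 1) * INR d * zeta 3 + 3 * (INR d + 1 / 2) * zeta 2
       - (12 * INR d ^ 6 - 50 * INR d ^ 4 - 81 * INR d ^ 3
          - 71 * INR d ^ 2 - 33 * INR d - 6)
         / (12 * INR d ^ 4 * (INR d + 1) ^ 3)).
Proof.
pose proof (INR_gt0 d hd) as hp.
split; [|split].
- apply expands_is_asymptotic_expansion.
  apply (expands_ext (fun b => (/ INR b) ^ (2 * k - 1) *
     (INR b ^ (2 * k - 1) * (irwin_sum b d k - INR b * ln (INR b))))).
  + exists 1%nat; intros b hb; pose proof (INR_gt0 b hb); rewrite pow_inv; field.
    apply pow_nonzero; lra.
  + apply expands_mul; [apply expands_pow, expands_inv | apply expands_irwin_sum; lia].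
- destruct (jet_horner_remainder _ _ (irwin_sum_jet d k hd hk)) as [r [[C [N hr]] [M he]]].
  exists C, (N + M + 1)%nat; intros b hb; pose proof (INR_gt0 b ltac:(lia)) as hb'.
  specialize (hr b ltac:(lia)); specialize (he b ltac:(lia)); cbn [horner length] in he.
  match goal with |- Rabs ?e <= _ => replace e with (r b * / INR b ^ (2 * k + 3)) end.
  + rewrite Rabs_mult; apply Rmult_le_compat_r; [apply Rabs_pos | exact hr].
  + replace (2 * k + 3)%nat with (2 * k - 1 + 4)%nat by lia.
    replace (2 * k + 2)%nat with (2 * k - 1 + 3)%nat by lia.
    replace (2 * k + 1)%nat with (2 * k - 1 + 2)%nat by lia.
    replace (2 * k)%nat with (2 * k - 1 + 1)%nat at 3 by lia.
    rewrite !pow_add; rewrite pow_inv in he.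
    assert (hnz : INR b ^ (2 * k - 1) <> 0) by (apply pow_nonzero; lra).
    set (y := INR b ^ (2 * k - 1)) in *.
    set (F := irwin_sum b d k) in *; set (l := ln (INR b)) in *.
    apply Rmult_eq_reg_l with y; [|exact hnz].
    transitivity (r b * / INR b ^ 4); [field; split; lra|].
    transitivity (y * (F - INR b * l) - (coef1 (INR d) + / INR b * (coef2 (INR d) (INR k) +
      / INR b * (coef3 (INR d) (INR k) + / INR b * (coef4 d k + / INR b * 0))))).
    * rewrite he; ring.
    * field; split; lra.
- intros ->; unfold coef4, coef4_generic, coef4_poly.
  replace (INR 3) with 3 by (simpl; ring).
  simpl Nat.eqb; cbv iota; field; lra.
Qed.
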